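(* Let $S$ be a finite inverse semigroup, with notation as in the context. Let $a,b\in D_k$ be idempotents and let $$f=\sum_{s\in S}f(s)\lfloor s\rfloor\in\mathbb{C}S,$$ where $f(s)=0$ unless $s\in D_k$, $s^{-1}s=a$ and $ss^{-1}=b$. Let $$f_G=\sum_{s\in D_k:\ ss^{-1}=b,\ s^{-1}s=a}f(s)\,p_b^{-1}sp_a\in\mathbb{C}G_k.$$ Write $\mathrm{IRR}(G_k)=\{\rho_1,\dots,\rho_q\}$. Let $W_i$ be the isotypic subspace of $\mathbb{C}G_k$ of type $\rho_i$ and $V_i$ the isotypic subspace of $\mathbb{C}S$ of type $\bar\rho_i$. Let $f_G^i=\sum_{g\in G_k}c_i(g)g$ be the projection of $f_G$ onto $W_i$, viewed as an element of $\mathbb{C}S$ via $G_k\subseteq S$. Then: 1. $f=\sum_{i=1}^q\lfloor p_b\rfloor f_G^i\lfloor p_a^{-1}\rfloor$; 2. for each $i$, $\lfloor p_b\rfloor f_G^i\lfloor p_a^{-1}\rfloor$ is the projection of $f$ onto $V_i$; 3. $\lfloor p_b\rfloor f_G^i\lfloor p_a^{-1}\rfloor=\lfloor p_b\rfloor\big(\sum_{g\in G_k}c_i(g)\lfloor g\rfloor\big)\lfloor p_a^{-1}\rfloor$.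
   Context: **Inverse semigroups and the natural order.** $S$ is a finite inverse semigroup: every $x$ has a unique $x^{-1}$ with $xx^{-1}x=x$ and $x^{-1}xx^{-1}=x^{-1}$. The natural partial order is $t\le s$ iff $t=es$ for an idempotent $e$, with Möbius function $\mu$. **Groupoid basis.** $\lfloor s\rfloor=\sum_{t\le s}\mu(t,s)t$; $\{\lfloor s\rfloor\}_{s\in S}$ is a basis of $\mathbb{C}S$. **$\mathcal{D}$-classes and maximal subgroups.** Elements $s,t$ are $\mathcal D$-related if some $u\in S$ has $u^{-1}u=s^{-1}s$ and $uu^{-1}=t^{-1}t$. The $\mathcal D$-classes are $D_0,\dots,D_n$. For each $k$: - $r_k$ is the number of idempotents in $D_k$; - $e_k\in D_k$ is a fixed idempotent; - $G_k=\{s:s^{-1}s=ss^{-1}=e_k\}$; - for each idempotent $a\in D_k$, $p_a$ is a fixed element with $p_a^{-1}p_a=e_k$ and $p_ap_a^{-1}=a$, with $p_{e_k}=e_k$. **Decomposition of $\mathbb{C}S$.** $\mathbb{C}D_k=\mathrm{span}\{\lfloor s\rfloor:s\in D_k\}$, and $\mathbb{C}S=\bigoplus_k\mathbb{C}D_k$. The map $\lfloor s\rfloor\mapsto(p_{ss^{-1}}^{-1}sp_{s^{-1}s})E_{ss^{-1},s^{-1}s}$ is an algebra isomorphism $\mathbb{C}D_k\cong M_{r_k}(\mathbb{C}G_k)$. **Irreducible representations.** For $\rho\in\mathrm{IRR}(G_k)$ (a complete set of inequivalent irreducible representations of $\mathbb{C}G_k$), $\bar\rho$ is the representation of $\mathbb{C}S$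 given by $\bar\rho(gE_{f,e})=E_{f,e}\otimes\rho(g)$ on $\mathbb{C}D_k$ and $0$ on the other $\mathbb{C}D_j$. The $\bar\rho$, over all $k$, form a complete set of inequivalent irreducible representations of $\mathbb{C}S$. **Isotypic subspaces.** For a semisimple algebra $A$ ($\mathbb{C}S$ or $\mathbb{C}G_k$) regarded as a left module over itself, the isotypic subspace of type $\rho$ is the sum of all simple left ideals isomorphic to $\rho$. $A$ is the direct sum of its isotypic subspaces, and projections are taken with respect to this decomposition. *)

(* Defs.v *)
From HB Require Import structures.
From mathcomp Require Import all_boot all_order all_algebra.
From mathcomp Require Export complex mxtens.
From mathcomp Require Export reals.
Set Implicit Arguments. Unset Strict Implicit. Unset Printing Implicit Defensive.
Import Order.TTheory GRing.Theory Num.Theory.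
Local Open Scope ring_scope.

Section InverseSemigroupAlgebra.
Variables (C : fieldType) (S : finType) (mul : S -> S -> S) (inv : S -> S).

Definition is_inverse_semigroup : Prop :=
  [/\ (forall x y z, mul x (mul y z) = mul (mul x y) z),
      (forall x, mul (mul x (inv x)) x = x /\ mul (mul (inv x) x) (inv x) = inv x) &
      (forall x y, mul (mul x y) x = x -> mul (mul y x) y = y -> y = inv x)].

Definition idem (e : S) : bool := mul e e == e.

Definition natle (t s : S) : bool := [exists e, idem e && (t == mul e s)].

Definition zetaM : 'M[C]_#|S| :=
  \matrix_(i, j) (natle (enum_val i) (enum_val j))%:R.
Definition moebius (t s : S) : C := invmx zetaM (enum_rank t) (enum_rank s).

Definition pt (s : S) : {ffun S -> C^o} := [ffun u => (u == s)%:R].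
Definition conv (x y : {ffun S -> C^o}) : {ffun S -> C^o} :=
  [ffun u => \sum_(s : S) \sum_(t : S) (mul s t == u)%:R * (x s * y t)].

Definition floor (s : S) : {ffun S -> C^o} :=
  \sum_(t : S | natle t s) moebius t s *: pt t.

Definition floorB : 'M[C]_#|S| := \matrix_(i, j) floor (enum_val j) (enum_val i).
Definition floor_coord (x : {ffun S -> C^o}) (s : S) : C :=
  (invmx floorB *m \col_i x (enum_val i)) (enum_rank s) 0.

Definition Drel (s t : S) : bool :=
  [exists u, (mul (inv u) u == mul (inv s) s) && (mul u (inv u) == mul (inv t) t)].
Definition Dclass (e : S) : {set S} := [set s | Drel s e].
Definition Gmax (e : S) : {set S} :=
  [set s | (mul (inv s) s == e) && (mul s (inv s) == e)].
Definition Eidem (e : S) : {set S} := [set a in Dclass e | idem a].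

(** CG_e, viewed inside CS (same convolution): functions supported on G_e *)
Definition CGmem (e : S) (x : {ffun S -> C^o}) : Prop :=
  forall s, s \notin Gmax e -> x s = 0.
Definition CSmem (x : {ffun S -> C^o}) : Prop := True.

Definition subspaceP (V : lmodType C) (U : V -> Prop) : Prop :=
  [/\ U 0, (forall x y, U x -> U y -> U (x + y)) &
      (forall (c : C) x, U x -> U (c *: x))].

Definition lideal (A : {ffun S -> C^o} -> Prop) (L : {ffun S -> C^o} -> Prop) : Prop :=
  [/\ subspaceP L, (forall x, L x -> A x) &
      (forall a x, A a -> L x -> L (conv a x))].

Definition simple_lideal A L : Prop :=
  [/\ lideal A L, (exists x, L x /\ x <> 0) &
      (forall L', lideal A L' -> (forall x, L' x -> L x) ->
         (forall x, L' x -> x = 0) \/ (forall x, L x -> L' x))].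

Definition iso_to A (L : {ffun S -> C^o} -> Prop) (d : nat)
   (tau : {ffun S -> C^o} -> 'M[C]_d) : Prop :=
  exists phi : {ffun S -> C^o} -> 'cV[C]_d,
    [/\ (forall x y, L x -> L y -> phi (x + y) = phi x + phi y),
        (forall (c : C) x, L x -> phi (c *: x) = c *: phi x),
        (forall x y, L x -> L y -> phi x = phi y -> x = y),
        (forall v, exists2 x, L x & phi x = v) &
        (forall a x, A a -> L x -> phi (conv a x) = tau a *m phi x)].

Definition isotypic A d (tau : {ffun S -> C^o} -> 'M[C]_d) (x : {ffun S -> C^o}) : Prop :=
  exists n (Ls : 'I_n -> {ffun S -> C^o} -> Prop) (xs : 'I_n -> {ffun S -> C^o}),
    (forall j, [/\ simple_lideal A (Ls j), iso_to A (Ls j) tau & Ls j (xs j)]) /\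
    x = \sum_(j < n) xs j.

(** sum of all simple left ideals NOT isomorphic to tau (= sum of the other
    isotypic subspaces) *)
Definition nonisotypic A d (tau : {ffun S -> C^o} -> 'M[C]_d) (x : {ffun S -> C^o}) : Prop :=
  exists n (Ls : 'I_n -> {ffun S -> C^o} -> Prop) (xs : 'I_n -> {ffun S -> C^o}),
    (forall j, [/\ simple_lideal A (Ls j), ~ iso_to A (Ls j) tau & Ls j (xs j)]) /\
    x = \sum_(j < n) xs j.

Definition proj_isotypic A d (tau : {ffun S -> C^o} -> 'M[C]_d) (x y : {ffun S -> C^o}) : Prop :=
  isotypic A tau y /\ nonisotypic A tau (x - y).

Definition grp_rep (e : S) d (rho : S -> 'M[C]_d) : Prop :=
  (forall g h, g \in Gmax e -> h \in Gmax e -> rho (mul g h) = rho g *m rho h) /\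
  rho e = 1%:M.

Definition irr_rep (e : S) d (rho : S -> 'M[C]_d) : Prop :=
  (0 < d)%N /\
  forall U : 'cV[C]_d -> Prop, subspaceP U ->
    (forall g v, g \in Gmax e -> U v -> U (rho g *m v)) ->
    (forall v, U v -> v = 0) \/ (forall v, U v).

Definition rep_equiv (e : S) d1 d2 (rho1 : S -> 'M[C]_d1) (rho2 : S -> 'M[C]_d2) : Prop :=
  exists (P : 'M[C]_(d1, d2)) (Q : 'M[C]_(d2, d1)),
    [/\ P *m Q = 1%:M, Q *m P = 1%:M &
        forall g, g \in Gmax e -> rho1 g *m P = P *m rho2 g].

Definition repext (e : S) d (rho : S -> 'M[C]_d) (x : {ffun S -> C^o}) : 'M[C]_d :=
  \sum_(g in Gmax e) x g *: rho g.

(** rho-bar: the representation of CS induced from rho via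
    CD_e ~ M_r(CG_e),  floor s |-> (p_{ss^-1}^-1 s p_{s^-1 s}) E_{ss^-1, s^-1 s},
    rhobar(g E_{f,e'}) = E_{f,e'} (x) rho(g), and 0 on the other CD_j. *)
Definition Eunit (e f e' : S) : 'M[C]_#|Eidem e| :=
  \matrix_(i, j) ((enum_val i == f) && (enum_val j == e'))%:R.

Definition rhobar_basis (e : S) (p : S -> S) d (rho : S -> 'M[C]_d) (s : S)
  : 'M[C]_(#|Eidem e| * d) :=
  if s \in Dclass e then
    Eunit e (mul s (inv s)) (mul (inv s) s)
      *t rho (mul (inv (p (mul s (inv s)))) (mul s (p (mul (inv s) s))))
  else 0.

Definition rhobar (e : S) (p : S -> S) d (rho : S -> 'M[C]_d) (x : {ffun S -> C^o})
  : 'M[C]_(#|Eidem e| * d) :=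
  \sum_(s : S) floor_coord x s *: rhobar_basis e p rho s.

End InverseSemigroupAlgebra.

Arguments pt {C S}.
Arguments floor {C S}.
Arguments moebius {C S}.
Arguments zetaM {C S}.
Arguments floorB {C S}.

(* Main.v *)
Require Import Defs.
From HB Require Import structures.
From mathcomp Require Import all_boot all_order all_algebra.
From mathcomp Require Import complex mxtens reals boolp.
Import Order.TTheory GRing.Theory Num.Theory.
Local Open Scope ring_scope.

(** In the coordinates [kap] of the groupoid basis, convolution on CS becomes
    convolution on the groupoid of S, so the blocks [blk c c'] of an element
    multiply like matrices over CG_k.  The map [emb b a], which puts an element
    of CG_k at position (b, a), is x |-> floor(p_b) x floor(p_a^-1).  Placing a
    simple left ideal L of CG_k in all the entries of column a gives a simple
    left ideal [lift a L] of CS, and L has type rho iff [lift a L] has type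
    rho-bar; hence [emb b a] carries the isotypic decomposition of f_G to that
    of f.

    That f_G is the sum of its projections comes from Schur's lemma together
    with the fact that an element x of CG_k killed by every rho_i is zero: the
    elements killed by all the rho_i form a left ideal, which, if nonzero, would
    contain a simple left ideal L; every l in L acts as zero on L, so
    l (l^* l) = 0 and therefore l = 0. *)

Set Implicit Arguments.
Unset Strict Implicit.

(** * Inverse semigroups *)

Section Semigroup.
Variables (S : finType) (mul : S -> S -> S) (inv : S -> S).
Hypothesis invS : is_inverse_semigroup mul inv.

Local Notation "x ** y" := (mul x y) (at level 40, left associativity).
Local Notation dom s := (mul (inv s) s).
Local Notation ran s := (mul s (inv s)).

Lemma smulA x y z : x ** (y ** z) = x ** y ** z.
Proof. by case: invS. Qed.

Lemma mulVK x : x ** inv x ** x = x.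
Proof. by case: invS => _ /(_ x)[]. Qed.

Lemma mulKV x : inv x ** x ** inv x = inv x.
Proof. by case: invS => _ /(_ x)[]. Qed.

Lemma inv_uniq x y : x ** y ** x = x -> y ** x ** y = y -> y = inv x.
Proof. by case: invS => _ _; apply. Qed.

Lemma sinvK x : inv (inv x) = x.
Proof. by apply/esym/inv_uniq; [apply: mulKV | apply: mulVK]. Qed.

Lemma idemP e : idem mul e -> e ** e = e.
Proof. by move/eqP. Qed.

Lemma idem_inv e : idem mul e -> inv e = e.
Proof. by move/idemP=> ee; apply/esym/inv_uniq; rewrite !ee. Qed.

(** With [x] the inverse of [e ** f], the element [f ** x ** e] is again an inverse of [e ** f],
    hence equals [x]. This form makes [x] idempotent, so [x] is its own inverse and [e ** f = x]. *)
Lemma idemM e f : idem mul e -> idem mul f -> idem mul (e ** f).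
Proof.
move=> /idemP ee /idemP ff; set x := inv (e ** f).
have K1 : e ** f ** x ** (e ** f) = e ** f by apply: mulVK.
have K2 : x ** (e ** f) ** x = x by apply: mulKV.
have fxe : f ** x ** e = x.
  apply: inv_uniq.
    have -> : e ** f ** (f ** x ** e) ** (e ** f) =
      e ** (f ** f) ** x ** (e ** e) ** f by rewrite !smulA.
    by rewrite ee ff -[RHS]K1 !smulA.
  have -> : f ** x ** e ** (e ** f) ** (f ** x ** e) =
     f ** (x ** ((e ** e) ** (f ** f)) ** x) ** e by rewrite !smulA.
  by rewrite ee ff K2.
have xx : x ** x = x.
  rewrite -{1 2}fxe.
  have -> : f ** x ** e ** (f ** x ** e) = f ** (x ** (e ** f) ** x) ** e.
    by rewrite !smulA.
  by rewrite K2.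
have ef : e ** f = x by rewrite -[LHS]sinvK -/x idem_inv // /idem xx.
by rewrite /idem ef xx.
Qed.

(** The product [f ** e] is an inverse of [e ** f], which as an idempotent is its own inverse. *)
Lemma idemC e f : idem mul e -> idem mul f -> e ** f = f ** e.
Proof.
move=> ie if_; have ef := idemM ie if_; have fe := idemM if_ ie.
rewrite -[LHS](idem_inv ef); apply/esym/inv_uniq.
  have -> : e ** f ** (f ** e) ** (e ** f) = e ** (f ** f) ** (e ** e) ** f.
    by rewrite !smulA.
  by rewrite !idemP // -!smulA -[RHS](idemP ef) !smulA.
have -> : f ** e ** (e ** f) ** (f ** e) = f ** (e ** e) ** (f ** f) ** e.
  by rewrite !smulA.
by rewrite !idemP // -!smulA -[RHS](idemP fe) !smulA.
Qed.

Lemma idem_dom s : idem mul (dom s).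
Proof. by rewrite /idem smulA mulKV. Qed.

Lemma idem_ran s : idem mul (ran s).
Proof. by rewrite /idem smulA mulVK. Qed.

(** Commuting the idempotents [ran y] and [dom x] in the middle gives both defining equations of an
    inverse. *)
Lemma sinvM x y : inv (x ** y) = inv y ** inv x.
Proof.
apply/esym/inv_uniq.
  have -> : x ** y ** (inv y ** inv x) ** (x ** y) = x ** (ran y ** dom x) ** y.
    by rewrite !smulA.
  by rewrite (idemC (idem_ran _) (idem_dom _)) !smulA mulVK -!smulA [y ** _]smulA mulVK.
have -> : inv y ** inv x ** (x ** y) ** (inv y ** inv x) =
  inv y ** (dom x ** ran y) ** inv x by rewrite !smulA.
rewrite (idemC (idem_dom _) (idem_ran _)) !smulA mulKV -!smulA.
by rewrite [inv x ** _]smulA mulKV.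
Qed.

Lemma ranM s t : ran (s ** t) = s ** ran t ** inv s.
Proof. by rewrite sinvM !smulA. Qed.

Lemma domM s t : dom (s ** t) = inv t ** dom s ** t.
Proof. by rewrite sinvM !smulA. Qed.

Lemma ranV s : ran (inv s) = dom s. Proof. by rewrite sinvK. Qed.

Lemma domV s : dom (inv s) = ran s. Proof. by rewrite sinvK. Qed.

(** If [t = e ** s], then [ran t = e ** ran s], so [ran t] can replace [e]. This turns the
    existential in the order into an equation. *)
Lemma natle_ran t s : natle mul t s = (t == ran t ** s).
Proof.
apply/existsP/eqP=> [[e /andP[ie /eqP ->]]|ts]; last first.
  by exists (ran t); rewrite idem_ran -ts /=.
rewrite ranM (idem_inv ie) -(idemC ie (idemM ie (idem_ran s))) !smulA idemP //.
by rewrite -2!smulA [s ** _]smulA mulVK.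
Qed.

Lemma natleMl e s : idem mul e -> natle mul (e ** s) s.
Proof. by move=> ie; apply/existsP; exists e; rewrite ie /=. Qed.

Lemma natle_refl s : natle mul s s.
Proof. by rewrite natle_ran mulVK. Qed.

Lemma natle_trans s t r : natle mul t s -> natle mul s r -> natle mul t r.
Proof.
case/existsP=> e /andP[ie /eqP ->] /existsP[f /andP[if_ /eqP ->]].
by rewrite smulA natleMl // idemM.
Qed.

Lemma natle_anti s t : natle mul t s -> natle mul s t -> t = s.
Proof.
case/existsP=> e /andP[ie /eqP te] /existsP[f /andP[if_ /eqP sf]].
have fes : f ** e ** s = s by rewrite -smulA -te -sf.
have es : e ** s = s by rewrite -{1}fes 2!smulA (idemC ie if_) -(smulA f) idemP.
by rewrite te es.
Qed.

End Semigroup.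

(** * The groupoid basis *)

Section GroupoidBasis.
Variables (C : fieldType) (S : finType) (mul : S -> S -> S) (inv : S -> S).
Hypothesis invS : is_inverse_semigroup mul inv.

Local Notation "x ** y" := (mul x y) (at level 40, left associativity).
Local Notation dom s := (mul (inv s) s).
Local Notation ran s := (mul s (inv s)).
Local Notation CS := {ffun S -> C^o}.
Local Notation "x '*c' y" := (conv (C:=C) mul x y) (at level 40, left associativity).
Local Notation flr := (floor (C:=C) mul).

(* An element below a product s t factors in exactly one way as a composable
   product in the groupoid of S. *)
Lemma natle_factor s t u v w :
  [&& natle mul u s, natle mul v t, dom u == ran v & u ** v == w] =
  [&& natle mul w (s ** t), u == ran w ** s & v == dom (ran w ** s) ** t].
Proof.
have iran := idem_ran invS; have idom := idem_dom invS.
apply/and4P/and3P=> [[us vt /eqP uv /eqP <-]|[wst /eqP uE /eqP vE]].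
  have rw : ran (u ** v) = ran u.
    by rewrite (ranM invS) -uv (smulA invS) (mulVK invS).
  have uE : ran u ** s = u by move: us; rewrite (natle_ran invS) => /eqP <-.
  have vE : dom u ** t = v.
    by move: vt; rewrite (natle_ran invS) uv => /eqP <-.
  rewrite rw uE vE !eqxx; split=> //.
  by rewrite (natle_ran invS) rw (smulA invS) uE -vE (smulA invS) (smulA invS u) (mulVK invS).
have wE : ran w ** s ** t = w.
  by move: wst; rewrite (natle_ran invS) (smulA invS) => /eqP <-.
have dE : dom (ran w ** s) = inv s ** ran w ** s.
  by rewrite (domM invS) (idem_inv invS (iran w)) (idemP (iran w)).
have vE' : v = inv s ** w by rewrite vE dE -2!(smulA invS) (smulA invS (ran w)) wE.
split.
- by rewrite uE natleMl.
- by rewrite vE natleMl.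
- by rewrite uE dE vE' (ranM invS) (sinvK invS).
- by rewrite vE -uE (smulA invS) (smulA invS u) (mulVK invS) uE wE.
Qed.

(** * Moebius inversion for the natural order *)

Lemma natle_ind (P : S -> Prop) :
  (forall u, (forall t, natle mul u t -> t != u -> P t) -> P u) -> forall u, P u.
Proof.
(* Induction on the number of elements above [u]. *)
move=> IH u; have [n] := ubnP #|[set t | natle mul u t]|.
elim: n u => // n IHn u un; apply: IH => t ut tu; apply: IHn.
rewrite ltnS in un; apply: leq_trans un; apply/proper_card/properP; split.
  apply/subsetP=> r; rewrite !inE; exact: (natle_trans invS ut).
exists u; rewrite !inE ?(natle_refl invS) //; apply/negP=> tu'.
by case/eqP: tu; apply: (natle_anti invS).
Qed.

(** Triangularity of the zeta matrix: the terms strictly above [u] vanish by induction. The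
    up-closed set [Q] confines the argument to a part of [S]. *)
Lemma upper_sum_eq0 (Q : pred S) (F : S -> C) :
  (forall u t, natle mul u t -> Q u -> Q t) ->
  (forall u, Q u -> \sum_(t | natle mul u t) F t = 0) ->
  forall u, Q u -> F u = 0.
Proof.
move=> Qup F0; elim/natle_ind=> u IH Qu.
have := F0 u Qu; rewrite (bigD1 u) ?(natle_refl invS) //= big1 ?addr0 // => t /andP[ut tu].
by apply: IH => //; apply: Qup ut Qu.
Qed.

Lemma sum_enum (F : S -> C) : \sum_(i < #|S|) F (enum_val i) = \sum_s F s.
Proof. by rewrite -(big_enum_val F). Qed.

Lemma zetaM_unit : zetaM (C:=C) mul \in unitmx.
Proof.
rewrite -unitmx_tr -row_free_unit; apply: inj_row_free => v v0.
apply/rowP=> i; rewrite mxE -(enum_valK i).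
apply: (@upper_sum_eq0 predT (fun s => v 0 (enum_rank s))) => // u _.
move/rowP: v0 => /(_ (enum_rank u)); rewrite !mxE => v0; apply: etrans v0.
rewrite big_mkcond -sum_enum; apply: eq_bigr => j _.
by rewrite !mxE enum_rankK enum_valK; case: natle; rewrite ?mulr1 ?mulr0.
Qed.

Lemma zeta_moebius u s : \sum_(t | natle mul u t) moebius (C:=C) mul t s = (u == s)%:R.
Proof.
have /matrixP/(_ (enum_rank u) (enum_rank s)) := mulmxV zetaM_unit.
rewrite !mxE (inj_eq enum_rank_inj) => <-.
rewrite big_mkcond -sum_enum; apply: eq_bigr => j _.
by rewrite !mxE enum_rankK /moebius enum_valK; case: natle; rewrite ?mul1r ?mul0r.
Qed.

(** For fixed [s], the elements not below [s] form an up-closed set on which the upper sums of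
    [moebius t s] are zero. *)
Lemma moebius_supp t s : ~~ natle mul t s -> moebius (C:=C) mul t s = 0.
Proof.
apply: (@upper_sum_eq0 (fun t => ~~ natle mul t s) (fun t => moebius mul t s)).
  by move=> u r ur; apply: contra; apply: (natle_trans invS ur).
move=> u us; rewrite zeta_moebius; case: eqP us => // ->.
by rewrite (natle_refl invS).
Qed.

Lemma floorE s t : flr s t = moebius (C:=C) mul t s.
Proof.
rewrite /floor sum_ffunE big_mkcond (bigD1 t) //= big1 => [|u ut].
  rewrite !ffunE eqxx addr0; case: (boolP (natle _ _ _)) => [_|/moebius_supp->//].
  by rewrite [_ *: _]mulr1.
by rewrite !ffunE eq_sym (negPf ut) [_ *: _]mulr0 if_same.
Qed.

(** The coefficient of [floor s] in [x]: by Moebius inversion, [pt t] is the sum of the [floor s]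
    with [s] below [t]. *)
Definition kap (s : S) (x : CS) : C^o := \sum_(t | natle mul s t) x t.

Lemma kap_is_linear s : linear (kap s).
Proof.
move=> c x y; rewrite /kap scaler_sumr -big_split /=.
by apply: eq_bigr => t _; rewrite !ffunE.
Qed.
HB.instance Definition _ s := GRing.isLinear.Build C CS C^o *:%R (kap s) (kap_is_linear s).

(** The entries of [floorB] are the Moebius values, so its inverse is the zeta matrix. *)
Lemma floor_coordE x s : floor_coord mul x s = kap s x.
Proof.
have -> : floor_coord mul x s = (zetaM mul *m \col_i x (enum_val i)) (enum_rank s) 0.
  rewrite -[zetaM mul]invmxK; congr ((invmx _ *m _) _ _).
  by apply/matrixP=> i j; rewrite mxE floorE /moebius !enum_valK.
rewrite /kap big_mkcond; apply: etrans (sum_enum (fun t => if natle mul s t then x t else 0)).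
rewrite mxE; apply: eq_bigr => j _; rewrite !mxE enum_rankK.
by case: natle; rewrite ?mul1r ?mul0r.
Qed.

Lemma kap_floor s t : kap s (flr t) = (s == t)%:R.
Proof.
by rewrite -zeta_moebius; apply: eq_bigr => r _; rewrite floorE.
Qed.

Lemma kap_inj x y : (forall s, kap s x = kap s y) -> x = y.
Proof.
move=> xy; apply/eqP; rewrite -subr_eq0; apply/eqP/ffunP=> s; rewrite [RHS]ffunE.
apply: (@upper_sum_eq0 predT (x - y)) => // u _.
by have : kap u (x - y) = 0 by rewrite linearB /= xy subrr.
Qed.

Lemma kap_sum_floor (P : pred S) (F : S -> C) s :
  kap s (\sum_(t | P t) F t *: flr t) = if P s then F s else 0.
Proof.
rewrite linear_sum big_mkcond (bigD1 s) //= big1 => [|u us].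
  by rewrite addr0 linearZ /= kap_floor eqxx [_ *: _]mulr1.
by rewrite linearZ /= kap_floor eq_sym (negPf us) [_ *: _]mulr0 if_same.
Qed.

Lemma floor_expand x : x = \sum_s kap s x *: flr s.
Proof. by apply: kap_inj => s; rewrite kap_sum_floor. Qed.

(** * Convolution in the groupoid basis *)

Lemma conv_is_linear x : linear (conv (C:=C) mul x).
Proof.
move=> c y z; apply/ffunP=> u; rewrite !ffunE scaler_sumr -big_split /=.
apply: eq_bigr => s _; rewrite scaler_sumr -big_split /=.
by apply: eq_bigr => t _; rewrite !ffunE !mulrDr !scalerAr.
Qed.
HB.instance Definition _ x := GRing.isLinear.Build C CS CS *:%R (conv mul x) (conv_is_linear x).

(** Expanding the coordinates on the right attaches to each pair [s], [t] the composable
    factorisations of [w] into factors below [s] and [t]. By [natle_factor] there is one if [w] is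
    below [s ** t], and none otherwise. *)
Lemma kap_conv x y w :
  kap w (x *c y) =
  \sum_u \sum_(v | (dom u == ran v) && (u ** v == w)) kap u x * kap v y.
Proof.
have -> : kap w (x *c y) = \sum_(r : S * S | natle mul w (r.1 ** r.2)) x r.1 * y r.2.
  rewrite /kap; under eq_bigr => u _ do rewrite ffunE pair_big /=.
  rewrite exchange_big [RHS]big_mkcond; apply: eq_bigr => -[s t] _ /=.
  case: (boolP (natle _ _ _)) => wst.
    rewrite (bigD1 (s ** t)) //= eqxx mul1r big1 ?addr0 // => u /andP[_].
    by rewrite eq_sym => /negPf->; rewrite mul0r.
  rewrite big1 // => u wu.
  by case: eqP => [E|_]; rewrite ?mul0r //; rewrite E wu in wst.
rewrite pair_big_dep /=; under [RHS]eq_bigr => uv _ do rewrite /kap big_distrlr pair_big /=.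
rewrite [RHS](exchange_big_dep predT) //= big_mkcond; apply: eq_bigr => -[s t] _ /=.
rewrite (eq_bigl (fun r : S * S => natle mul w (s ** t) &&
   (r == (ran w ** s, dom (ran w ** s) ** t)))) => [|[u v] /=]; last first.
  by rewrite xpair_eqE -natle_factor andbC -andbA.
by case: natle; rewrite ?big_pred1_eq ?big_pred0.
Qed.
(** In a composable factorisation of [w] the right factor determines the left one. *)
Lemma kap_convV x y w :
  kap w (x *c y) = \sum_(v | dom v == dom w) kap (w ** inv v) x * kap v y.
Proof.
rewrite kap_conv (exchange_big_dep predT) //= [RHS]big_mkcond; apply: eq_bigr => v _.
rewrite (eq_bigl (fun u => (dom v == dom w) && (u == w ** inv v))) => [|u].
  by case: ifP => _; rewrite ?big_pred1_eq ?big_pred0.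
apply/andP/andP=> -[/eqP dE /eqP uE].
  split; apply/eqP; rewrite -uE; first by rewrite (domM invS) dE (smulA invS) (mulKV invS).
  by rewrite -(smulA invS) -dE (smulA invS) (mulVK invS).
split; apply/eqP; rewrite uE.
  by rewrite (domM invS) (sinvK invS) -dE (smulA invS) (mulVK invS).
by rewrite -(smulA invS) dE (smulA invS) (mulVK invS).
Qed.

Lemma floorM s t : flr s *c flr t = if dom s == ran t then flr (s ** t) else 0.
Proof.
apply: kap_inj => w; rewrite kap_conv (bigD1 s) //= [X in _ + X]big1 => [|u us]; last first.
  by apply: big1 => v _; rewrite kap_floor (negPf us) mul0r.
rewrite addr0; under eq_bigr => v _ do rewrite !kap_floor eqxx mul1r.
case: ifP => st; last first.
  rewrite linear0; apply: big1 => v /andP[sv _].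
  by case: eqP => // vt; rewrite -vt sv in st.
rewrite kap_floor (eq_sym w) big_mkcond (bigD1 t) //= st eqxx big1 => [|v /negPf->].
  by rewrite addr0; case: eqP.
by rewrite if_same.
Qed.

Lemma kap_pt s t : kap s (pt t) = (natle mul s t)%:R.
Proof.
rewrite /kap big_mkcond (bigD1 t) //= ffunE eqxx big1 => [|u /negPf ut].
  by rewrite addr0; case: natle.
by rewrite ffunE ut if_same.
Qed.

(** Among the [floor u] in the expansion of [pt t], only [u = t] has range [dom s]. So [pt t] acts
    here as [floor t] would. *)
Lemma floorMpt s t : dom s = ran t -> flr s *c pt t = flr (s ** t).
Proof.
move=> st; rewrite [X in _ *c X]floor_expand linear_sum (bigD1 t) //= big1 => [|u ut].
  by rewrite linearZ /= kap_pt (natle_refl invS) scale1r floorM st eqxx addr0.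
rewrite linearZ /= kap_pt; case: (boolP (natle _ _ _)); rewrite ?scale0r //.
rewrite floorM (natle_ran invS) st; case: (ran t =P ran u) => [<-|_ _]; last by rewrite scaler0.
by rewrite (mulVK invS) (negPf ut).
Qed.

(** The swapped arguments let linearity in the left factor be registered too. *)
Definition convr (y x : CS) : CS := x *c y.

Lemma convr_is_linear y : linear (convr y).
Proof.
move=> c x z; apply/ffunP=> u; rewrite /convr !ffunE scaler_sumr -big_split /=.
apply: eq_bigr => s _; rewrite scaler_sumr -big_split /=.
by apply: eq_bigr => t _; rewrite !ffunE mulrDl mulrDr -!scalerAl -scalerAr.
Qed.
HB.instance Definition _ y := GRing.isLinear.Build C CS CS *:%R (convr y) (convr_is_linear y).

Lemma convZl k x y : (k *: x) *c y = k *: (x *c y).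
Proof. by rewrite -[LHS]/(convr y (k *: x)) linearZ. Qed.

Lemma conv_suml I (r : seq I) (P : pred I) (F : I -> CS) y :
  (\sum_(i <- r | P i) F i) *c y = \sum_(i <- r | P i) F i *c y.
Proof. exact: (linear_sum (convr y)). Qed.

Lemma convZr k x y : x *c (k *: y) = k *: (x *c y).
Proof. exact: linearZ. Qed.

Lemma conv_sumr I (r : seq I) (P : pred I) (F : I -> CS) x :
  x *c (\sum_(i <- r | P i) F i) = \sum_(i <- r | P i) x *c F i.
Proof. exact: linear_sum. Qed.

Lemma conv0l y : 0 *c y = 0.
Proof. exact: (linear0 (convr y)). Qed.

Lemma conv0r x : x *c 0 = 0.
Proof. exact: linear0. Qed.

Lemma pt_sum (P : pred S) (F : S -> C) u :
  (\sum_(s | P s) F s *: pt s : CS) u = if P u then F u else 0.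
Proof.
rewrite sum_ffunE big_mkcond (bigD1 u) //= big1 => [|s us].
  by rewrite !ffunE eqxx addr0 [_ *: _]mulr1.
by rewrite !ffunE eq_sym (negPf us) [_ *: _]mulr0 if_same.
Qed.

Lemma pt_expand (x : CS) : x = \sum_s x s *: pt s.
Proof. by apply/ffunP=> s; rewrite pt_sum. Qed.

Lemma ptM s t : pt s *c pt t = pt (s ** t) :> CS.
Proof.
apply/ffunP=> u; rewrite !ffunE (bigD1 s) //= [X in _ + X]big1 => [|r rs]; last first.
  by apply: big1 => v _; rewrite !ffunE (negPf rs) mul0r mulr0.
rewrite addr0 (bigD1 t) //= big1 => [|r rt]; last first.
  by rewrite !ffunE (negPf rt) !mulr0.
by rewrite !ffunE !eqxx !mulr1 addr0 eq_sym.
Qed.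

Lemma convA x y z : x *c (y *c z) = x *c y *c z.
Proof.
rewrite (pt_expand x) !conv_suml; apply: eq_bigr => s _; rewrite !convZl; congr (_ *: _).
rewrite (pt_expand y) linear_sum !conv_suml linear_sum; apply: eq_bigr => t _.
rewrite linearZ /= !convZl linearZ /=; congr (_ *: _).
rewrite (pt_expand z) !linear_sum; apply: eq_bigr => r _.
by rewrite !linearZ /= !ptM (smulA invS).
Qed.

End GroupoidBasis.

(** * The matrix algebra of a D-class *)

Section Blocks.
Variables (C : fieldType) (S : finType) (mul : S -> S -> S) (inv : S -> S).
Variables (ek : S) (p : S -> S).
Hypothesis invS : is_inverse_semigroup mul inv.
Hypothesis iek : idem mul ek.
Local Notation E := (Eidem mul inv ek).
Local Notation G := (Gmax mul inv ek).
Local Notation "x ** y" := (mul x y) (at level 40, left associativity).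
Local Notation dom s := (mul (inv s) s).
Local Notation ran s := (mul s (inv s)).
Hypothesis pP : forall e, e \in E -> dom (p e) = ek /\ ran (p e) = e.
Local Notation CS := {ffun S -> C^o}.
Local Notation "x '*c' y" := (conv (C:=C) mul x y) (at level 40, left associativity).
Local Notation flr := (floor (C:=C) mul).
Local Notation kap := (kap (C:=C) mul).
Local Notation inCG := (CGmem (C:=C) mul inv ek).

Let mA := smulA invS.

Lemma pdom c : c \in E -> dom (p c) = ek. Proof. by case/pP. Qed.
Lemma pran c : c \in E -> ran (p c) = c. Proof. by case/pP. Qed.
Lemma Dclass_dom s : (s \in Dclass mul inv ek) = (dom s \in E).
Proof.
rewrite !inE /Drel (idem_inv invS (idem_dom invS s)) (idemP (idem_dom invS s)).
by rewrite (idem_dom invS) andbT.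
Qed.

Lemma Eidem_dom s : ran s \in E -> dom s \in E.
Proof.
rewrite -Dclass_dom !inE /Drel (idem_inv invS (idem_ran invS s)) (idemP (idem_ran invS s)).
(* The element [u] links [ran s] to [ek], so [u ** s] links [dom s] to [ek]. *)
case/andP=> /existsP[u /andP[/eqP du /eqP ru]] _; apply/existsP; exists (u ** s).
rewrite (domM invS) (ranM invS) du -ru !mA (mulKV invS) eqxx /=.
by rewrite -(mA u) -du mA (mulVK invS).
Qed.

Lemma Eidem_ran s : (ran s \in E) = (dom s \in E).
Proof.
apply/idP/idP; first exact: Eidem_dom.
by rewrite -(ranV invS) => /Eidem_dom; rewrite (domV invS).
Qed.

Lemma Gmax_dom g : g \in G -> dom g = ek.
Proof. by rewrite inE => /andP[/eqP]. Qed.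
Lemma Gmax_ran g : g \in G -> ran g = ek.
Proof. by rewrite inE => /andP[_ /eqP]. Qed.

Lemma Gmax1 : ek \in G.
Proof. by rewrite inE (idem_inv invS iek) (idemP iek) eqxx. Qed.

Lemma GmaxMe g : g \in G -> g ** ek = g.
Proof. by move=> Gg; rewrite -(Gmax_dom Gg) mA (mulVK invS). Qed.
Lemma GmaxeM g : g \in G -> ek ** g = g.
Proof. by move=> Gg; rewrite -(Gmax_ran Gg) (mulVK invS). Qed.

Lemma GmaxM g h : g \in G -> h \in G -> g ** h \in G.
Proof.
move=> Gg Gh; rewrite inE (domM invS) (ranM invS) (Gmax_dom Gg) (Gmax_ran Gh).
by rewrite (GmaxMe Gg) (Gmax_ran Gg) -mA (GmaxeM Gh) (Gmax_dom Gh) eqxx.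
Qed.

Lemma GmaxV g : g \in G -> inv g \in G.
Proof. by rewrite !inE (domV invS) (ranV invS) andbC. Qed.

Lemma GmaxMV g h : g \in G -> h \in G -> g ** inv h ** h = g.
Proof. by move=> Gg Gh; rewrite -mA (Gmax_dom Gh) GmaxMe. Qed.

Lemma pMe c : c \in E -> p c ** ek = p c.
Proof. by move=> Ec; rewrite -(pdom Ec) mA (mulVK invS). Qed.
(** In the groupoid, the elements with range [c] and domain [c'] form a copy of [G]. The map
    [unarrow] is the one used in the isomorphism of CD_k with M_r(CG_k), and [arrow] is its
    inverse. *)
Definition arrow c g c' := p c ** g ** inv (p c').
Definition unarrow c s c' := inv (p c) ** s ** p c'.

Lemma arrow_ran c g c' : c \in E -> c' \in E -> g \in G -> ran (arrow c g c') = c.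
Proof.
move=> Ec Ec' Gg; rewrite (ranM invS) (ranV invS) pdom // -(mA (p c)) GmaxMe //.
by rewrite (sinvM invS) mA -(mA (p c)) Gmax_ran // pMe // pran.
Qed.

Lemma arrow_dom c g c' : c \in E -> c' \in E -> g \in G -> dom (arrow c g c') = c'.
Proof.
move=> Ec Ec' Gg; rewrite (domM invS) (sinvK invS) (domM invS) pdom // -(mA _ ek) GmaxeM //.
by rewrite Gmax_dom // pMe // pran.
Qed.

Lemma arrowK c g c' : c \in E -> c' \in E -> g \in G -> unarrow c (arrow c g c') c' = g.
Proof.
move=> Ec Ec' Gg; rewrite /unarrow /arrow 2!mA pdom // GmaxeM //.
by rewrite -mA pdom // GmaxMe.
Qed.

Lemma unarrowK c s c' : ran s = c -> dom s = c' -> c \in E ->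
  arrow c (unarrow c s c') c' = s.
Proof.
move=> rs ds Ec; have Ec' : c' \in E by rewrite -ds -Eidem_ran rs.
rewrite /arrow /unarrow 2!mA pran // -(mA _ (p c')) pran //.
by rewrite -{1}rs (mulVK invS) -ds mA (mulVK invS).
Qed.

Lemma unarrowG c s c' : ran s = c -> dom s = c' -> c \in E -> unarrow c s c' \in G.
Proof.
move=> rs ds Ec; have Ec' : c' \in E by rewrite -ds -Eidem_ran rs.
have K e x : e \in E -> x = p e -> inv x ** e ** x = ek.
  by move=> Ee ->; rewrite -{2}(pran Ee) mA (mulKV invS) pdom.
have dsE : dom (inv (p c) ** s) = c'.
  by rewrite (domM invS) (sinvK invS) pran // -rs mA (mulKV invS).
have rsE : ran (s ** p c') = c.
  by rewrite (ranM invS) pran // -ds mA (mulVK invS).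
rewrite inE /unarrow (domM invS) dsE (K c') // eqxx /=.
by rewrite -(mA _ s (p c')) (ranM invS) rsE (sinvK invS) (K c).
Qed.

Lemma arrowM c c' c'' g h : c' \in E -> g \in G ->
  arrow c g c' ** arrow c' h c'' = arrow c (g ** h) c''.
Proof.
move=> Ec' Gg; rewrite /arrow !mA -(mA (p c ** g)) pdom //.
by rewrite -(mA _ g ek) GmaxMe.
Qed.

Lemma arrowV c g c' : inv (arrow c g c') = arrow c' (inv g) c.
Proof. by rewrite /arrow !(sinvM invS) (sinvK invS) mA. Qed.

Lemma CGmem_conv x y : inCG x -> inCG y -> inCG (x *c y).
Proof.
move=> xG yG w wG; rewrite ffunE big1 // => s _; rewrite big1 // => t _.
have [Gs|/xG->] := boolP (s \in G); last by rewrite mul0r mulr0.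
have [Gt|/yG->] := boolP (t \in G); last by rewrite !mulr0.
by case: eqP wG => [<-|]; rewrite ?GmaxM // mul0r.
Qed.

Lemma CGmem_convE x y g : inCG x -> inCG y -> g \in G ->
  (x *c y) g = \sum_(t in G) x (g ** inv t) * y t.
Proof.
move=> xG yG Gg; rewrite ffunE exchange_big [RHS]big_mkcond; apply: eq_bigr => t _ /=.
case: ifP => Gt; last first.
  by apply: big1 => s _; rewrite yG ?Gt // !mulr0.
rewrite (bigD1 (g ** inv t)) //= GmaxMV // eqxx mul1r big1 ?addr0 // => s sg.
have [Gs|/xG->] := boolP (s \in G); last by rewrite mul0r mulr0.
case: (s ** t =P g) sg => [<-|_ _]; last by rewrite mul0r.
by rewrite -mA Gmax_ran // GmaxMe // eqxx.
Qed.

(** The entry at (c, c') of the matrix over CG_k attached to [x], stored as a function on [S] that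
    vanishes off [G]. *)
Definition blk (c c' : S) (x : CS) : CS :=
  [ffun g => if g \in G then kap (arrow c g c') x else 0].

Lemma blk_is_linear c c' : linear (blk c c').
Proof.
move=> k x y; apply/ffunP=> g; rewrite !ffunE.
by case: ifP => _; rewrite ?linearP // scaler0 addr0.
Qed.
HB.instance Definition _ c c' := GRing.isLinear.Build C CS CS *:%R (blk c c') (blk_is_linear c c').

Lemma CGmem_blk c c' x : inCG (blk c c' x).
Proof. by move=> g /negPf Gg; rewrite ffunE Gg. Qed.

Lemma CGmem_sum I (r : seq I) (P : pred I) (F : I -> CS) :
  (forall i, P i -> inCG (F i)) -> inCG (\sum_(i <- r | P i) F i).
Proof. by move=> FG s sG; rewrite sum_ffunE big1 // => i Pi; apply: FG. Qed.

(** The groupoid sum for the product is split by the range [c'] of the right factor. Each piece,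
    transported to [G] by [unarrow], is a convolution in CG_k. *)
Lemma blk_conv c c'' x y : c \in E -> c'' \in E ->
  blk c c'' (x *c y) = \sum_(c' in E) blk c c' x *c blk c' c'' y.
Proof.
move=> Ec Ec''; apply/ffunP=> g; have [Gg|Gg] := boolP (g \in G); last first.
  by rewrite CGmem_blk // CGmem_sum // => c' Ec'; apply: CGmem_conv; apply: CGmem_blk.
rewrite ffunE Gg sum_ffunE (kap_convV invS) arrow_dom //.
rewrite (partition_big (fun v => ran v) (mem E)) => [|v /eqP vE]; last by rewrite /= Eidem_ran vE.
apply: eq_bigr => c' Ec'; rewrite CGmem_convE //; try exact: CGmem_blk.
rewrite (reindex_onto (fun t => arrow c' t c'') (fun v => unarrow c' v c'')) /=; last first.
  by move=> v /andP[/eqP dv /eqP rv]; rewrite unarrowK.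
apply: eq_big => [t|t /andP[/andP[/eqP dt /eqP rt] /eqP ut]].
  apply/andP/idP=> [[/andP[/eqP dt /eqP rt] /eqP <-]|Gt].
    exact: unarrowG.
  by rewrite arrow_dom // arrow_ran // arrowK // !eqxx.
have Gt : t \in G by rewrite -ut unarrowG.
by rewrite arrowV arrowM // !ffunE Gt GmaxM // GmaxV.
Qed.

(** The matrix over CG_k with [x] at position (c, c') and zeros elsewhere, read back in CS. *)
Definition emb (c c' : S) (x : CS) : CS := \sum_(g in G) x g *: flr (arrow c g c').

Lemma emb_is_linear c c' : linear (emb c c').
Proof.
move=> k x y; rewrite /emb scaler_sumr -big_split /=; apply: eq_bigr => g _.
by rewrite !ffunE scalerDl scalerA.
Qed.
HB.instance Definition _ c c' := GRing.isLinear.Build C CS CS *:%R (emb c c') (emb_is_linear c c').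

Lemma kap_emb c c' x s :
  kap s (emb c c' x) = \sum_(g in G) x g * (s == arrow c g c')%:R.
Proof.
by rewrite linear_sum; apply: eq_bigr => g _; rewrite linearZ /= (kap_floor _ invS).
Qed.

Lemma blk_emb c c' c1 c2 x : c \in E -> c' \in E -> c1 \in E -> c2 \in E -> inCG x ->
  blk c1 c2 (emb c c' x) = if (c1 == c) && (c2 == c') then x else 0.
Proof.
move=> Ec Ec' Ec1 Ec2 xG; apply/ffunP=> g; rewrite ffunE.
case: ifP => Gg; last by case: ifP => _; rewrite ?xG ?ffunE ?Gg.
rewrite kap_emb; case: ifP => [/andP[/eqP-> /eqP->]|cc].
  rewrite (bigD1 g) //= eqxx mulr1 big1 ?addr0 // => h /andP[Gh /eqP hg].
  case: eqP => [/(congr1 (fun s => unarrow c s c'))|_]; last by rewrite mulr0.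
  by rewrite !arrowK // => /esym/hg.
rewrite ffunE big1 // => h Gh; case: eqP => [e|_]; last by rewrite mulr0.
have := congr1 (fun s => ran s) e; have := congr1 (fun s => dom s) e.
by rewrite /= !arrow_dom // !arrow_ran // => e1 e2; rewrite e1 e2 !eqxx in cc.
Qed.

(** Membership in the column of CS indexed by [a], which is stable under left convolution. *)
Definition rsupp (a : S) (y : CS) := forall s, dom s != a -> kap s y = 0.

Lemma rsupp_conv a x y : rsupp a y -> rsupp a (x *c y).
Proof.
move=> ya s sa; rewrite (kap_convV invS) big1 // => v /eqP vs.
by rewrite ya ?mulr0 // vs.
Qed.

Lemma rsupp_emb c a x : c \in E -> a \in E -> rsupp a (emb c a x).
Proof.
move=> Ec Ea s sa; rewrite kap_emb big1 // => g Gg; case: eqP => [e|_]; last by rewrite mulr0.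
by rewrite e arrow_dom // eqxx in sa.
Qed.

(** An element with domain in [E] also has its range in [E], so the blocks of column [a] see every
    coordinate supported there. *)
Lemma blk_ext a y z : a \in E -> rsupp a y -> rsupp a z ->
  (forall c, c \in E -> blk c a y = blk c a z) -> y = z.
Proof.
move=> Ea ya za yz; apply: (kap_inj invS) => s.
have [ds|ds] := eqVneq (dom s) a; last by rewrite ya ?za.
have Er : ran s \in E by rewrite Eidem_ran ds.
have := congr1 (fun x : CS => x (unarrow (ran s) s a)) (yz _ Er).
by rewrite !ffunE unarrowG // unarrowK.
Qed.

Lemma emb_conv c c' a x y : c \in E -> c' \in E -> a \in E -> inCG x -> rsupp a y ->
  emb c c' x *c y = emb c a (x *c blk c' a y).
Proof.
move=> Ec Ec' Ea xG ya; apply: (blk_ext Ea) => [||c1 Ec1].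
- exact: rsupp_conv.
- exact: rsupp_emb.
rewrite blk_conv // (bigD1 c') //= big1 => [|c2 /andP[Ec2 /negPf c2E]].
  rewrite addr0 !blk_emb ?eqxx ?andbT //; last by apply: CGmem_conv => //; apply: CGmem_blk.
  by case: ifP => // _; rewrite conv0l.
by rewrite blk_emb // c2E andbF conv0l.
Qed.

Lemma emb_blk a y : a \in E -> rsupp a y -> y = \sum_(c in E) emb c a (blk c a y).
Proof.
move=> Ea ya; apply: (blk_ext Ea) => // [s sa|c Ec].
  by rewrite linear_sum big1 // => c Ec; apply: rsupp_emb.
rewrite linear_sum (bigD1 c) //= big1 => [|c1 /andP[Ec1 cc1]].
  by rewrite addr0 blk_emb ?eqxx //; apply: CGmem_blk.
by rewrite blk_emb //; [rewrite eq_sym (negPf cc1) | apply: CGmem_blk].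
Qed.

Lemma CGmem_expand x : inCG x -> x = \sum_(g in G) x g *: pt g.
Proof.
by move=> xG; apply/ffunP=> g; rewrite pt_sum; case: ifP => // Gg; rewrite xG ?Gg.
Qed.

(** The domain [ek] of [p b] is the range of every [g] in [G], so [floor (p b)] times [pt g] is
    already a floor element. *)
Lemma floor_conv_emb a b x : a \in E -> b \in E -> inCG x ->
  flr (p b) *c x *c flr (inv (p a)) = emb b a x.
Proof.
move=> Ea Eb xG; rewrite {1}(CGmem_expand xG) (conv_sumr _ _ _ _ (flr (p b))) conv_suml /emb.
apply: eq_bigr => g Gg; rewrite convZr convZl (floorMpt _ invS) ?pdom ?Gmax_ran //.
rewrite (floorM _ invS) (ranV invS) (domM invS) !pdom // -mA (GmaxeM Gg) (Gmax_dom Gg).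
by rewrite eqxx.
Qed.

(** The same value arises with the coefficients on the groupoid basis, which yields the third
    claim. *)
Lemma floor_conv_emb_floor a b (x : CS) : a \in E -> b \in E ->
  flr (p b) *c (\sum_(g in G) x g *: flr g) *c flr (inv (p a)) = emb b a x.
Proof.
move=> Ea Eb; rewrite (conv_sumr _ _ _ _ (flr (p b))) conv_suml /emb.
apply: eq_bigr => g Gg; rewrite convZr convZl (floorM _ invS) pdom // Gmax_ran // eqxx.
rewrite (floorM _ invS) (ranV invS) (domM invS) !pdom // -mA (GmaxeM Gg) (Gmax_dom Gg).
by rewrite eqxx.
Qed.

End Blocks.

(** * Schur's lemma and simple left ideals *)

Section LinearAlgebra.
Variable C : fieldType.

Lemma mulmx_cV_inj m n (A B : 'M[C]_(m, n)) :
  (forall v : 'cV_n, A *m v = B *m v) -> A = B.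
Proof.
move=> AB; apply/matrixP=> i j.
by have /colP/(_ i) := AB (delta_mx j 0); rewrite -!colE !mxE.
Qed.

Lemma subspaceP_sum (V : lmodType C) (U : V -> Prop) I (r : seq I) (P : pred I) (F : I -> V) :
  subspaceP U -> (forall i, P i -> U (F i)) -> U (\sum_(i <- r | P i) F i).
Proof. by case=> U0 UD _ UF; apply: big_ind. Qed.

(** Starting from the zero space, vectors of [U] are adjoined to [W] until none is missing; [n]
    bounds the codimension of [W]. *)
Lemma subspaceP_vspace (V : vectType C) (U : V -> Prop) :
  subspaceP U -> exists W : {vspace V}, forall x, U x <-> x \in W.
Proof.
case=> U0 UD UZ.
suff H n (W : {vspace V}) : (forall x, x \in W -> U x) ->
    (\dim (fullv : {vspace V}) - \dim W <= n)%N ->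
    exists W' : {vspace V}, forall x, U x <-> x \in W'.
  apply: (H (\dim (fullv : {vspace V})) 0%VS) => [x|]; last exact: leq_subr.
  by rewrite memv0 => /eqP->.
elim: n W => [|n IHn] W WU dW; case: (EM (exists x, U x /\ x \notin W)) => [[x [Ux xW]]|nex].
- case/negP: xW; apply: subvP (memvf x); rewrite -dimv_leqif_sup ?subvf //.
  by rewrite eqn_leq dimvS ?subvf // -subn_eq0 -leqn0.
- by exists W => x; split=> [Ux|/WU //]; apply: contrapT => /negP xW; apply: nex; exists x.
- have WW' : (\dim W < \dim (W + <[x]>))%N.
    rewrite (ltn_leqif (dimv_leqif_sup (addvSl _ _))); apply: contra xW => /subvP; apply.
    by apply: (subvP (addvSr _ _)); apply: memv_line.
  apply: (IHn (W + <[x]>)%VS) => [y /memv_addP[w /WU Uw [z /vlineP[k ->] ->]]|].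
    by apply: UD => //; apply: UZ.
  rewrite -ltnS; apply: leq_trans dW; apply: ltn_sub2l => //.
  by apply: leq_trans WW' _; apply: dimvS; apply: subvf.
- by exists W => x; split=> [Ux|/WU //]; apply: contrapT => /negP xW; apply: nex; exists x.
Qed.

(** Linearity is asked on [L] only, because [iso_to] constrains its map only there. *)
Definition linear_on (V W : lmodType C) (L : V -> Prop) (phi : V -> W) : Prop :=
  (forall x y, L x -> L y -> phi (x + y) = phi x + phi y) /\
  (forall (c : C) x, L x -> phi (c *: x) = c *: phi x).

Lemma linear_on_sum (V W : lmodType C) (L : V -> Prop) (phi : V -> W)
    I (r : seq I) (P : pred I) (F : I -> V) :
  subspaceP L -> linear_on L phi -> (forall i, P i -> L (F i)) ->
  phi (\sum_(i <- r | P i) F i) = \sum_(i <- r | P i) phi (F i).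
Proof.
move=> LS [phiD phiZ] LF; have [L0 LD _] := LS.
have : L (\sum_(i <- r | P i) F i) /\
  phi (\sum_(i <- r | P i) F i) = \sum_(i <- r | P i) phi (F i); last by case.
apply: (big_ind2 (fun x y => L x /\ phi x = y)) => [|x1 x2 y1 y2 [L1 <-] [L2 <-]|i Pi].
- by split=> //; rewrite -(scale0r 0) phiZ // scale0r.
- by split; [apply: LD | apply: phiD].
- by split=> //; apply: LF.
Qed.

Definition coordcol (V : vectType C) n (X : n.-tuple V) (x : V) : 'cV[C]_n :=
  \col_i coord X i x.

Lemma coordcol_is_linear (V : vectType C) n (X : n.-tuple V) : linear (coordcol X).
Proof. by move=> k x y; apply/colP=> i; rewrite !mxE linearP. Qed.
HB.instance Definition _ (V : vectType C) n (X : n.-tuple V) :=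
  GRing.isLinear.Build C V 'cV[C]_n *:%R (coordcol X) (coordcol_is_linear X).

Definition colvec (V : vectType C) n (X : n.-tuple V) (v : 'cV[C]_n) : V :=
  \sum_i v i 0 *: X`_i.

Lemma colvecK (V : vectType C) n (X : n.-tuple V) : free X -> cancel (colvec X) (coordcol X).
Proof. by move=> fX v; apply/colP=> i; rewrite mxE coord_sum_free. Qed.

Lemma coordcolK (V : vectType C) (U : {vspace V}) x :
  x \in U -> colvec (vbasis U) (coordcol (vbasis U) x) = x.
Proof.
by move=> Ux; rewrite [RHS](coord_vbasis Ux); apply: eq_bigr => i _; rewrite mxE.
Qed.

Lemma colvec_in (V : vectType C) (U : {vspace V}) v : colvec (vbasis U) v \in U.
Proof.
apply: memv_suml => i _; apply: memvZ; apply: vbasis_mem.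
by apply: mem_nth; rewrite size_tuple.
Qed.

End LinearAlgebra.

(** * Simple left ideals and their identifications with column spaces *)

Section Ideals.
Variables (C : fieldType) (S : finType) (mul : S -> S -> S).
Local Notation CS := {ffun S -> C^o}.

(** Descent on the dimension of an enclosing space: a nonzero left ideal that is not simple properly
    contains a nonzero one. *)
Lemma exists_simple_lideal (A L : CS -> Prop) :
  lideal mul A L -> (exists x, L x /\ x <> 0) ->
  exists L', simple_lideal mul A L' /\ forall x, L' x -> L x.
Proof.
have [n] : exists n, exists2 U : {vspace CS}, (forall x, L x -> x \in U) & (\dim U < n)%N.
  by exists (\dim (fullv : {vspace CS})).+1, fullv => // x _; apply: memvf.
elim: n L => [|n IHn] L [U LU //] dU LA Lx.
case: (EM (simple_lideal mul A L)) => [sL|nsL]; first by exists L.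
have [L' [L'A [L'L [[x [L'x x0]] [y [Ly L'y]]]]]] : exists L', lideal mul A L' /\
   (forall x, L' x -> L x) /\ (exists x, L' x /\ x <> 0) /\ exists y, L y /\ ~ L' y.
  apply: contrapT => H; apply: nsL; split=> // L' L'A L'L.
  case: (EM (exists x, L' x /\ x <> 0)) => [L'x|nx]; [right|left] => x Lx'.
    by apply: contrapT => L'x'; apply: H; exists L'; do !split=> //; exists x.
  by apply: contrapT => x0; apply: nx; exists x.
have [W WE] : exists W : {vspace CS}, forall x, L' x <-> x \in W.
  by apply: subspaceP_vspace; case: L'A.
have dW : (\dim W < \dim U)%N.
  rewrite (ltn_leqif (dimv_leqif_sup _)).
    by apply/negP=> /subvP UW; apply: L'y; apply/WE; apply: UW; apply: LU.
  by apply/subvP=> z /WE L'z; apply: LU; apply: L'L.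
have [||L'' [sL'' L''L']] := IHn L' _ L'A; last by exists L''; split=> // z /L''L' /L'L.
  by exists W => [z /WE//|]; apply: leq_trans dW _.
by exists x.
Qed.

(** The composite of [phi1] with the inverse of [phi2] is linear, hence a matrix. Its columns are
    the values of [phi1] at the preimages [e k] of the unit vectors. *)
Lemma iso_matrix (L : CS -> Prop) d1 d2 (phi1 : CS -> 'cV[C]_d1) (phi2 : CS -> 'cV[C]_d2) :
  subspaceP L -> linear_on L phi1 -> linear_on L phi2 ->
  (forall x y, L x -> L y -> phi2 x = phi2 y -> x = y) ->
  (forall v, exists2 x, L x & phi2 x = v) ->
  exists P : 'M[C]_(d1, d2), forall x, L x -> phi1 x = P *m phi2 x.
Proof.
move=> LS lin1 lin2 inj2 surj2; have [_ _ LZ] := LS.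
have [e eP] : exists e : 'I_d2 -> CS, forall k, L (e k) /\ phi2 (e k) = delta_mx k 0.
  have ex k : exists x, L x /\ phi2 x = delta_mx k 0.
    by case: (surj2 (delta_mx k 0)) => x; exists x.
  have [e eP] := boolp.choice ex; exists e; exact: eP.
exists (\matrix_(i, k) phi1 (e k) i 0) => x Lx.
have Le k : L (phi2 x k 0 *: e k) by apply: LZ; case: (eP k).
have -> : x = \sum_k phi2 x k 0 *: e k.
  apply: inj2 => //; first exact: subspaceP_sum.
  rewrite (linear_on_sum _ LS lin2) // [LHS]matrix_sum_delta; apply: eq_bigr => k _.
  by rewrite big_ord1 (proj2 lin2) ?(proj2 (eP k)) //; case: (eP k).
rewrite !(linear_on_sum _ LS) //; apply/colP=> i; rewrite summxE mxE.
apply: eq_bigr => k _; rewrite (proj2 lin1) ?mxE; last by case: (eP k).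
rewrite mulrC; congr (_ * _).
rewrite summxE (bigD1 k) //= big1 => [|j jk].
  rewrite (proj2 lin2); last by case: (eP k).
  by rewrite (proj2 (eP k)) !mxE !eqxx mulr1 addr0.
rewrite (proj2 lin2); last by case: (eP j).
by rewrite (proj2 (eP j)) !mxE eq_sym (negPf jk) mulr0.
Qed.

End Ideals.

(** * Representations of CG_k and its simple left ideals *)

Section GroupAlgebra.
Variables (C : fieldType) (S : finType) (mul : S -> S -> S) (inv : S -> S) (ek : S).
Hypothesis invS : is_inverse_semigroup mul inv.
Local Notation G := (Gmax mul inv ek).
Local Notation "x ** y" := (mul x y) (at level 40, left associativity).
Local Notation CS := {ffun S -> C^o}.
Local Notation "x '*c' y" := (conv (C:=C) mul x y) (at level 40, left associativity).
Local Notation inCG := (CGmem (C:=C) mul inv ek).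
Local Notation ext := (repext (C:=C) mul inv ek).

Lemma repext_is_linear d (rho : S -> 'M[C]_d) : linear (ext rho).
Proof.
move=> k x y; rewrite /repext scaler_sumr -big_split /=; apply: eq_bigr => g _.
by rewrite !ffunE scalerDl scalerA.
Qed.
HB.instance Definition _ d (rho : S -> 'M[C]_d) :=
  GRing.isLinear.Build C CS 'M[C]_d *:%R (ext rho) (repext_is_linear rho).

Lemma repextD d (rho : S -> 'M[C]_d) x y : ext rho (x + y) = ext rho x + ext rho y.
Proof. exact: (linearD (ext rho)). Qed.

Lemma repextB d (rho : S -> 'M[C]_d) x y : ext rho (x - y) = ext rho x - ext rho y.
Proof. exact: (linearB (ext rho)). Qed.

Lemma repextZ d (rho : S -> 'M[C]_d) k x : ext rho (k *: x) = k *: ext rho x.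
Proof. exact: (linearZZ (ext rho)). Qed.

Lemma repext0 d (rho : S -> 'M[C]_d) : ext rho 0 = 0.
Proof. exact: (linear0 (ext rho)). Qed.

Lemma repext_sum d (rho : S -> 'M[C]_d) I (r : seq I) (P : pred I) (F : I -> CS) :
  ext rho (\sum_(i <- r | P i) F i) = \sum_(i <- r | P i) ext rho (F i).
Proof. exact: (linear_sum (ext rho)). Qed.

Lemma repext_pt d (rho : S -> 'M[C]_d) g : g \in G -> ext rho (pt g) = rho g.
Proof.
move=> Gg; rewrite /repext (bigD1 g) //= ffunE eqxx scale1r big1 ?addr0 // => h /andP[_ /negPf hg].
by rewrite ffunE hg scale0r.
Qed.

Lemma CGmem_pt g : g \in G -> inCG (pt g).
Proof. by move=> Gg s; rewrite ffunE; case: eqP => // ->; rewrite Gg. Qed.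

Lemma repext_conv d (rho : S -> 'M[C]_d) x y : grp_rep mul inv ek rho ->
  inCG x -> inCG y -> ext rho (x *c y) = ext rho x *m ext rho y.
Proof.
move=> [rhoM _] xG yG; rewrite {1}(CGmem_expand xG) conv_suml repext_sum.
rewrite [ext rho x]/repext mulmx_suml.
apply: eq_bigr => g Gg; rewrite convZl repextZ -scalemxAl; congr (_ *: _).
rewrite {1}(CGmem_expand yG) conv_sumr repext_sum [ext rho y]/repext mulmx_sumr.
apply: eq_bigr => h Gh; rewrite convZr repextZ -scalemxAr; congr (_ *: _).
by rewrite ptM repext_pt ?rhoM // (GmaxM invS).
Qed.

Lemma conv1l x : inCG x -> pt ek *c x = x.
Proof.
move=> xG; rewrite [in LHS](CGmem_expand xG) conv_sumr [RHS](CGmem_expand xG).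
by apply: eq_bigr => g Gg; rewrite convZr ptM (GmaxeM invS).
Qed.

Lemma conv_expand x y : inCG x -> x *c y = \sum_(g in G) x g *: (pt g *c y).
Proof.
move=> xG; rewrite {1}(CGmem_expand xG) conv_suml.
by apply: eq_bigr => g _; rewrite convZl.
Qed.

Lemma repext_stable d (rho : S -> 'M[C]_d) (U : 'cV[C]_d -> Prop) x v :
  subspaceP U -> (forall g v, g \in G -> U v -> U (rho g *m v)) -> U v ->
  U (ext rho x *m v).
Proof.
move=> US UG Uv; rewrite /repext mulmx_suml; apply: subspaceP_sum => // g Gg.
by rewrite -scalemxAl; case: US => _ _; apply; apply: UG.
Qed.

(** For each vector [v], sending [x] to [ext rho x *m v] is a module morphism on [L]. Its kernel is
    zero or [L], its image zero or everything. Zero kernel with full image would be an isomorphism,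
    so the morphism is zero. *)
Lemma schur_eq0 (L : CS -> Prop) d (rho : S -> 'M[C]_d) :
  grp_rep mul inv ek rho -> irr_rep mul inv ek rho -> simple_lideal mul inCG L ->
  ~ iso_to mul inCG L (ext rho) -> forall x, L x -> ext rho x = 0.
Proof.
move=> rhoR [d0 rhoI] [[[L0 LD LZ] LA LM] _ Lmin] niso x Lx.
apply: mulmx_cV_inj => v; rewrite mul0mx; move: x Lx.
have M a x : inCG a -> L x -> ext rho (a *c x) *m v = ext rho a *m (ext rho x *m v).
  by move=> aG Lx; rewrite repext_conv // -?mulmxA //; apply: LA.
have [||K0|//] := Lmin (fun x => L x /\ ext rho x *m v = 0); last 1 first.
- by move=> KL x /KL[].
- split; first split.
  + by rewrite repext0 mul0mx.
  + by move=> x y [Lx x0] [Ly y0]; rewrite repextD mulmxDl x0 y0 addr0; split=> //; apply: LD.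
  + by move=> c x [Lx x0]; rewrite repextZ -scalemxAl x0 scaler0; split=> //; apply: LZ.
  + by move=> x [Lx _]; apply: LA.
  + by move=> a x aG [Lx x0]; rewrite M // x0 mulmx0; split=> //; apply: LM.
- by move=> x [].
have [||W0|W1] := rhoI (fun w => exists2 x, L x & ext rho x *m v = w).
- split; first by exists 0; rewrite // repext0 mul0mx.
    by move=> _ _ [x Lx <-] [y Ly <-]; exists (x + y); rewrite ?repextD ?mulmxDl //; apply: LD.
  by move=> c _ [x Lx <-]; exists (c *: x); rewrite ?repextZ -?scalemxAl //; apply: LZ.
- move=> g _ Gg [x Lx <-]; exists (pt g *c x); first by apply: LM => //; apply: CGmem_pt.
  by rewrite M ?repext_pt //; apply: CGmem_pt.
- by move=> x Lx; apply: W0; exists x.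
case: niso; exists (fun x => ext rho x *m v); split=> //.
- by move=> x y _ _; rewrite repextD mulmxDl.
- by move=> c x _; rewrite repextZ -scalemxAl.
- move=> x y Lx Ly xy; apply/eqP; rewrite -subr_eq0; apply/eqP; apply: K0; split.
    by rewrite -scaleN1r; apply: LD => //; apply: LZ.
  by rewrite repextB mulmxBl xy subrr.
Qed.

(** The two isomorphisms put coordinates on [L]; the changes of coordinates [P] and [Q] are mutually
    inverse and intertwine the actions. *)
Lemma iso_to_rep_equiv (L : CS -> Prop) d1 d2 (rho1 : S -> 'M[C]_d1) (rho2 : S -> 'M[C]_d2) :
  lideal mul inCG L -> iso_to mul inCG L (ext rho1) -> iso_to mul inCG L (ext rho2) ->
  rep_equiv mul inv ek rho1 rho2.
Proof.
move=> [LS LA LM] [phi1 [D1 Z1 I1 S1 M1]] [phi2 [D2 Z2 I2 S2 M2]].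
have [P PE] := iso_matrix LS (conj D1 Z1) (conj D2 Z2) I2 S2.
have [Q QE] := iso_matrix LS (conj D2 Z2) (conj D1 Z1) I1 S1.
exists P, Q; split.
- by apply: mulmx_cV_inj => v; have [x Lx <-] := S1 v; rewrite mul1mx -mulmxA -QE // PE.
- by apply: mulmx_cV_inj => v; have [x Lx <-] := S2 v; rewrite mul1mx -mulmxA -PE // QE.
move=> g Gg; apply: mulmx_cV_inj => v; have [x Lx <-] := S2 v.
have gG := CGmem_pt Gg.
rewrite -!mulmxA -PE // -(repext_pt rho1 Gg) -(repext_pt rho2 Gg) -M1 // -M2 // PE //.
exact: LM.
Qed.

Lemma iso_to_equiv (L : CS -> Prop) d1 d2 (rho1 : S -> 'M[C]_d1) (rho2 : S -> 'M[C]_d2) :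
  iso_to mul inCG L (ext rho1) -> rep_equiv mul inv ek rho1 rho2 ->
  iso_to mul inCG L (ext rho2).
Proof.
move=> [phi [phiD phiZ phiI phiS phiM]] [P [Q [PQ QP PE]]].
have QE x : Q *m ext rho1 x = ext rho2 x *m Q.
  rewrite /repext mulmx_suml mulmx_sumr; apply: eq_bigr => g Gg.
  rewrite -scalemxAl -scalemxAr; congr (_ *: _).
  by rewrite -[LHS]mulmx1 -PQ mulmxA -(mulmxA Q) PE // mulmxA QP mul1mx.
exists (fun x => Q *m phi x); split.
- by move=> x y Lx Ly; rewrite phiD // mulmxDr.
- by move=> c x Lx; rewrite phiZ // -scalemxAr.
- move=> x y Lx Ly xy; apply: phiI => //.
  by rewrite -[LHS]mul1mx -[RHS]mul1mx -PQ -!mulmxA xy.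
- by move=> v; have [x Lx xv] := phiS (P *m v); exists x => //; rewrite xv mulmxA QP mul1mx.
- by move=> a x aG Lx; rewrite phiM // !mulmxA QE.
Qed.

(** In a basis of [L], left multiplication by [g] has a matrix [sigma g]. Stable subspaces
    correspond to left ideals inside [L], so simplicity becomes irreducibility. *)
Lemma simple_lideal_rep (L : CS -> Prop) : simple_lideal mul inCG L ->
  exists d (sigma : S -> 'M[C]_d),
    [/\ grp_rep mul inv ek sigma, irr_rep mul inv ek sigma & iso_to mul inCG L (ext sigma)].
Proof.
move=> [[LS LA LM] [x0 [Lx0 x00]] Lmin].
have [U UE] := subspaceP_vspace LS.
pose phi := coordcol (vbasis U); pose lin := colvec (vbasis U).
have phi0 : phi 0 = 0 by exact: (linear0 (coordcol _)).
have phiD x y : phi (x + y) = phi x + phi y by exact: (linearD (coordcol _)).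
have phiZ c x : phi (c *: x) = c *: phi x by exact: (linearZZ (coordcol _)).
have phiS I (r : seq I) (P : pred I) (F : I -> CS) :
    phi (\sum_(i <- r | P i) F i) = \sum_(i <- r | P i) phi (F i).
  by exact: (linear_sum (coordcol _)).
have phiK x : L x -> lin (phi x) = x by move/UE/coordcolK.
have linK : cancel lin phi by apply: colvecK; apply: basis_free (vbasisP U).
have linL v : L (lin v) by apply/UE; apply: colvec_in.
pose sigma g : 'M[C]_(\dim U) := \matrix_(i, j) coord (vbasis U) i (pt g *c (vbasis U)`_j).
have sigmaE g v : sigma g *m v = phi (pt g *c lin v).
  apply/colP=> i; rewrite !mxE /lin /colvec conv_sumr linear_sum; apply: eq_bigr => j _.
  by rewrite convZr linearZ /= mxE mulrC.
have extE x v : inCG x -> ext sigma x *m v = phi (x *c lin v).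
  move=> xG; rewrite (conv_expand _ xG) /repext mulmx_suml phiS; apply: eq_bigr => g Gg.
  by rewrite phiZ -scalemxAl sigmaE.
have phiM a x : inCG a -> L x -> phi (a *c x) = ext sigma a *m phi x.
  by move=> aG Lx; rewrite extE // phiK.
exists (\dim U), sigma; split.
- split=> [g h Gg Gh|]; apply: mulmx_cV_inj => v; last first.
    by rewrite mul1mx sigmaE conv1l ?linK //; apply: LA.
  rewrite -mulmxA !sigmaE phiK; first by rewrite (convA invS) ptM.
  by apply: LM => //; apply: CGmem_pt.
- split.
    rewrite lt0n dimv_eq0; apply/eqP=> U0; apply: x00.
    by move/UE: Lx0; rewrite U0 memv0 => /eqP.
  move=> W WS WG; have [W0 WD WZ] := WS.
  have [||K0|K1] := Lmin (fun x => L x /\ W (phi x)).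
  + have [L0 LD LZ] := LS; split; first split.
    * by rewrite phi0.
    * by move=> x y [Lx Wx] [Ly Wy]; rewrite phiD; split; [apply: LD | apply: WD].
    * by move=> c x [Lx Wx]; rewrite phiZ; split; [apply: LZ | apply: WZ].
    * by move=> x [Lx _]; apply: LA.
    * by move=> a x aG [Lx Wx]; rewrite phiM //; split; [apply: LM | apply: repext_stable].
  + by move=> x [].
  + by left=> v Wv; rewrite -(linK v) (K0 (lin v)) ?phi0 // linK.
  + by right=> v; rewrite -(linK v); case: (K1 (lin v) (linL v)).
- exists phi; split=> //.
  + by move=> x y Lx Ly xy; rewrite -(phiK x) // xy phiK.
  + by move=> v; exists (lin v).
Qed.

End GroupAlgebra.

(** * Completeness of the irreducible representations *)

Section Completeness.
Variables (R : realType) (S : finType) (mul : S -> S -> S) (inv : S -> S) (ek : S).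
Local Notation C := R[i].
Hypothesis invS : is_inverse_semigroup mul inv.
Hypothesis iek : idem mul ek.
Local Notation G := (Gmax mul inv ek).
Local Notation "x ** y" := (mul x y) (at level 40, left associativity).
Local Notation CS := {ffun S -> C^o}.
Local Notation "x '*c' y" := (conv (C:=C) mul x y) (at level 40, left associativity).
Local Notation inCG := (CGmem (C:=C) mul inv ek).
Local Notation ext := (repext (C:=C) mul inv ek).

(** The usual involution of the group algebra, set to zero off [G]. *)
Definition star (x : CS) : CS := [ffun g => if g \in G then (x (inv g))^* else 0].

Lemma CGmem_star x : inCG (star x).
Proof. by move=> g /negPf Gg; rewrite ffunE Gg. Qed.

Lemma star_convE x g : inCG x -> g \in G ->
  (star x *c x) g = \sum_(t in G) (x (t ** inv g))^* * x t.
Proof.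
move=> xG Gg; rewrite (CGmem_convE invS _ xG) //; last exact: CGmem_star.
apply: eq_bigr => t Gt; rewrite ffunE (GmaxM invS) ?(GmaxV invS) //.
by rewrite (sinvM invS) (sinvK invS).
Qed.

(** The coefficient of [star x *c x] at [ek] is the sum of the squared moduli of the coefficients of
    [x]. *)
Lemma star_conv_eq0 x : inCG x -> star x *c x = 0 -> x = 0.
Proof.
move=> xG x0; have Ge := Gmax1 invS iek.
have := star_convE xG Ge; rewrite x0 ffunE => /esym/eqP.
rewrite psumr_eq0 => [/allP xx|t Gt]; last first.
  by rewrite (idem_inv invS iek) (GmaxMe invS) // mulrC mul_conjC_ge0.
apply/ffunP=> g; rewrite [RHS]ffunE; have [Gg|/xG//] := boolP (g \in G).
have /implyP/(_ Gg) := xx g (mem_index_enum g).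
by rewrite (idem_inv invS iek) (GmaxMe invS) // mulrC mul_conjC_eq0 => /eqP.
Qed.

Lemma star_star_conv x : inCG x -> star (star x *c x) = star x *c x.
Proof.
move=> xG; apply/ffunP=> g; have [Gg|Gg] := boolP (g \in G); last first.
  by rewrite ffunE (negPf Gg) (CGmem_conv invS _ xG) //; apply: CGmem_star.
have GVg := GmaxV invS Gg.
rewrite [LHS]ffunE Gg !star_convE // (sinvK invS) rmorph_sum /=.
(* Replacing [t] by [t ** inv g] turns [x (t ** g)] into [x t], as in the sum on the right. *)
rewrite (reindex_onto (fun t => t ** inv g) (fun t => t ** g)) /=; last first.
  by move=> t Gt; rewrite -(smulA invS) (Gmax_ran Gg) (GmaxMe invS).
apply: eq_big => [t|t /andP[Gt /eqP tE]].
  apply/andP/idP=> [[Gt /eqP <-]|Gt]; first exact: (GmaxM invS).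
  by rewrite (GmaxM invS) // (GmaxMV invS Gt Gg).
by rewrite tE rmorphM /= conjCK mulrC.
Qed.

(** Positivity is used twice. For the self-adjoint [y = star x *c x], the product [star y *c y]
    equals [star x *c (x *c y)] and vanishes, so [y = 0] and then [x = 0]. *)
Lemma conv_cube_eq0 x : inCG x -> x *c (star x *c x) = 0 -> x = 0.
Proof.
move=> xG x0; apply: star_conv_eq0 => //; apply: star_conv_eq0.
  by apply: (CGmem_conv invS) => //; apply: CGmem_star.
by rewrite star_star_conv // -(convA invS) x0 conv0r.
Qed.

Variables (q : nat) (d : 'I_q -> nat) (rho : forall i : 'I_q, S -> 'M[C]_(d i)).
Hypothesis rhoR : forall i, grp_rep mul inv ek (rho i).
Hypothesis rhoI : forall i, irr_rep mul inv ek (rho i).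
Hypothesis rho_inj : forall i j, i != j -> ~ rep_equiv mul inv ek (rho i) (rho j).
Hypothesis rho_compl : forall (d' : nat) (sigma : S -> 'M[C]_d'),
  grp_rep mul inv ek sigma -> irr_rep mul inv ek sigma ->
  exists i, rep_equiv mul inv ek sigma (rho i).

Lemma repext_faithful x : inCG x -> (forall i, ext (rho i) x = 0) -> x = 0.
Proof.
move=> xG x0; apply: contrapT => xn0.
have [||L [sL LI]] := @exists_simple_lideal C S mul inCG
    (fun x => inCG x /\ forall i, ext (rho i) x = 0).
- split; first split.
  + by split=> [s _|i]; rewrite ?ffunE ?repext0.
  + move=> y z [yG y0] [zG z0]; split=> [s sG|i]; last by rewrite repextD y0 z0 addr0.
    by rewrite ffunE yG // zG // addr0.
  + move=> c y [yG y0]; split=> [s sG|i]; last by rewrite repextZ y0 scaler0.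
    by rewrite ffunE yG // scaler0.
  + by move=> y [].
  + move=> a y aG [yG y0]; split=> [|i]; first exact: (CGmem_conv invS).
    by rewrite repext_conv // y0 mulmx0.
- by exists x.
have [[LS LA LM] [l [Ll l0]] _] := sL; case: l0.
have [d' [sigma [sR sI Liso]]] := simple_lideal_rep invS sL.
have [i /(iso_to_equiv Liso)[phi [phiD phiZ phiI phiS phiM]]] := rho_compl sR sI.
have lG := LA _ Ll; have Lh : L (star l *c l) by apply: LM => //; apply: CGmem_star.
have L0 : L 0 by case: LS.
apply: conv_cube_eq0 => //; apply: phiI => //; first exact: LM.
(* As [L] has type [rho i] and [rho i] kills [l], the element [l] acts as zero on [star l *c l]. *)
rewrite phiM // (proj2 (LI _ Ll)) mul0mx.
by rewrite -[X in phi X](scale0r 0) phiZ // scale0r.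
Qed.

(** By faithfulness it suffices that each [rho i] kills the difference. Schur's lemma kills
    [x - y i], and also every other [y j], since an ideal of both types would make [rho j] and
    [rho i] equivalent. *)
Lemma isotypic_sum x (y : 'I_q -> CS) : inCG x ->
  (forall i, proj_isotypic mul inCG (ext (rho i)) x (y i)) -> x = \sum_i y i.
Proof.
move=> xG xy; apply/eqP; rewrite -subr_eq0; apply/eqP.
have yG i : inCG (y i).
  have [[n [Ls [xs [xsP ->]]]] _] := xy i; apply: CGmem_sum => j _.
  by have [[[_ LA _] _ _] _ /LA] := xsP j.
have sumG : inCG (\sum_i y i) by apply: CGmem_sum => i _; apply: yG.
apply: repext_faithful => [s sG|i].
  by rewrite [LHS]ffunE xG // ffunE sumG // oppr0 addr0.
have -> : x - \sum_j y j = (x - y i) - \sum_(j | j != i) y j.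
  by rewrite (bigD1 i) //= opprD addrA.
rewrite repextB repext_sum big1 => [|j ji].
  rewrite subr0; have [_ [n [Ls [xs [xsP ->]]]]] := xy i.
  rewrite repext_sum big1 // => j _; have [sL niso Lx] := xsP j.
  exact: (schur_eq0 invS (rhoR i) (rhoI i) sL).
have [[n [Ls [xs [xsP ->]]]] _] := xy j.
rewrite repext_sum big1 // => k _; have [sL iso Lx] := xsP k.
apply: (schur_eq0 invS (rhoR i) (rhoI i) sL) => // iso'.
by apply: (rho_inj ji); apply: iso_to_rep_equiv iso iso'; case: sL.
Qed.

End Completeness.
(** * From the maximal subgroup to the semigroup *)

Section Lifting.
Variables (C : fieldType) (S : finType) (mul : S -> S -> S) (inv : S -> S).
Variables (ek : S) (p : S -> S).
Hypothesis invS : is_inverse_semigroup mul inv.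
Hypothesis iek : idem mul ek.
Local Notation E := (Eidem mul inv ek).
Local Notation G := (Gmax mul inv ek).
Local Notation "x ** y" := (mul x y) (at level 40, left associativity).
Local Notation dom s := (mul (inv s) s).
Local Notation ran s := (mul s (inv s)).
Hypothesis pP : forall e, e \in E -> dom (p e) = ek /\ ran (p e) = e.
Local Notation CS := {ffun S -> C^o}.
Local Notation "x '*c' y" := (conv (C:=C) mul x y) (at level 40, left associativity).
Local Notation kap := (kap (C:=C) mul).
Local Notation inCG := (CGmem (C:=C) mul inv ek).
Local Notation inCS := (@CSmem C S).
Local Notation ext := (repext (C:=C) mul inv ek).
Local Notation bar := (rhobar (C:=C) mul inv ek p).
Local Notation arrow := (arrow mul inv p).
Local Notation blk := (blk (C:=C) mul inv ek p).
Local Notation emb := (emb (C:=C) mul inv ek p).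
Local Notation rsupp := (rsupp (C:=C) mul inv).

(** Columns of length [m * d] are read as [m] stacked blocks, in the indexing of the tensor product
    of matrices. *)
Definition vblk m d (i : 'I_m) (v : 'cV[C]_(m * d)) : 'cV[C]_d :=
  \col_j v (mxtens_index (i, j)) 0.

Lemma vblk_is_linear m d (i : 'I_m) : linear (@vblk m d i).
Proof. by move=> k x y; apply/colP=> j; rewrite !mxE. Qed.
HB.instance Definition _ m d (i : 'I_m) :=
  GRing.isLinear.Build C 'cV[C]_(m * d) 'cV[C]_d *:%R (@vblk m d i) (@vblk_is_linear m d i).

Definition vglue m d (w : 'I_m -> 'cV[C]_d) : 'cV[C]_(m * d) :=
  \col_k w (mxtens_unindex k).1 (mxtens_unindex k).2 0.

Lemma vblkK m d (w : 'I_m -> 'cV[C]_d) i : vblk i (vglue w) = w i.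
Proof. by apply/colP=> j; rewrite !mxE mxtens_indexK. Qed.

Lemma vblk_ext m d (v w : 'cV[C]_(m * d)) : (forall i, vblk i v = vblk i w) -> v = w.
Proof.
move=> vw; apply/colP=> k; rewrite -(mxtens_unindexK k).
by case: (mxtens_unindex k) => i j; have /colP/(_ j) := vw i; rewrite !mxE.
Qed.

Lemma vblk_tens m d (A : 'M[C]_m) (B : 'M[C]_d) v i :
  vblk i ((A *t B) *m v) = \sum_j A i j *: (B *m vblk j v).
Proof.
apply/colP=> k; rewrite !mxE summxE.
rewrite (reindex (fun u : 'I_m * 'I_d => mxtens_index u)) /=; last first.
  by exists (@mxtens_unindex m d) => u _; rewrite ?mxtens_indexK ?mxtens_unindexK.
transitivity (\sum_(j < m) \sum_(l < d)
  (A *t B) (mxtens_index (i, k)) (mxtens_index (j, l)) * v (mxtens_index (j, l)) 0).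
  by rewrite pair_bigA; apply: eq_bigr => -[].
apply: eq_bigr => j _; rewrite !mxE big_distrr /=; apply: eq_bigr => l _.
by rewrite tensmxE !mxE mulrA.
Qed.

(** An element [s] of the D-class contributes only to the block at ([ran s], [dom s]), through [rho]
    of its [unarrow]; other elements contribute nothing. So rho-bar is [rho] applied entrywise to
    the matrix over CG_k. *)
Lemma rhobar_vblk d (rho : S -> 'M[C]_d) z v i :
  vblk i (bar rho z *m v) =
  \sum_j ext rho (blk (enum_val i) (enum_val j) z) *m vblk j v.
Proof.
rewrite /rhobar mulmx_suml (linear_sum (vblk i)).
transitivity (\sum_s \sum_j ((ran s == enum_val i) && (dom s == enum_val j))%:R *:
    (kap s z *: (rho (inv (p (enum_val i)) ** (s ** p (enum_val j))) *m vblk j v))).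
  apply: eq_bigr => s _; rewrite (floor_coordE invS) -scalemxAl.
  rewrite (linearZZ (vblk i)) /= /rhobar_basis.
  case: ifP => sD.
    rewrite vblk_tens scaler_sumr; apply: eq_bigr => j _; rewrite mxE.
    rewrite eq_sym (eq_sym _ (dom s)).
    by case: eqP => [->|_]; case: eqP => [->|_]; rewrite ?scale1r ?scale0r ?scaler0.
  rewrite mul0mx (linear0 (vblk i)) scaler0 big1 // => j _.
  case: (dom s =P _) => [dE|_]; last by rewrite andbF scale0r.
  by move: sD; rewrite (Dclass_dom _ invS) dE enum_valP.
rewrite exchange_big; apply: eq_bigr => j _ /=.
set ci := enum_val i; set cj := enum_val j.
have Ei : ci \in E by apply: enum_valP.
have Ej : cj \in E by apply: enum_valP.
transitivity (\sum_(s | (ran s == ci) && (dom s == cj))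
    kap s z *: (rho (unarrow mul inv p ci s cj) *m vblk j v)).
  rewrite [RHS]big_mkcond; apply: eq_bigr => s _; rewrite /unarrow -(smulA invS).
  by case: andb; rewrite ?scale1r ?scale0r.
rewrite (reindex_onto (fun g => arrow ci g cj) (fun s => unarrow mul inv p ci s cj)) /=; last first.
  by move=> s /andP[/eqP rs /eqP ds]; rewrite (unarrowK invS pP).
rewrite /repext mulmx_suml; apply: eq_big => [g|g /andP[/andP[/eqP rs /eqP ds] /eqP gE]].
  apply/andP/idP=> [[/andP[/eqP rs /eqP ds] /eqP <-]|Gg].
    exact: (unarrowG invS pP).
  by rewrite (arrow_ran invS pP) // (arrow_dom invS pP) // (arrowK invS pP) // !eqxx.
have Gg : g \in G by rewrite -gE (unarrowG invS pP).
by rewrite -scalemxAl ffunE Gg gE.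
Qed.

Lemma Eidem_ek : ek \in E.
Proof.
rewrite !inE iek andbT; apply/existsP; exists ek.
by rewrite (idem_inv invS iek) (idemP iek) eqxx.
Qed.

Lemma emb_pt b a g : g \in G -> emb b a (pt g) = floor mul (arrow b g a).
Proof.
move=> Gg; rewrite /emb (bigD1 g) //= ffunE eqxx scale1r big1 ?addr0 // => h /andP[_ /negPf hg].
by rewrite ffunE hg scale0r.
Qed.

(** * Lifting left ideals of CG_k to columns of CS *)

Section LiftIdeal.
Variables (a : S) (L : CS -> Prop).
Hypothesis Ea : a \in E.

(* The left ideal of CS corresponding, under CD_k = M_r(CG_k), to the column
   indexed by a with all its entries in L. *)
Definition lift (y : CS) : Prop := rsupp a y /\ forall c, c \in E -> L (blk c a y).

(** The matrix unit [emb c c' (pt ek)] moves the entry in row [c'] to row [c], because [pt ek] is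
    the identity of CG_k. *)
Lemma emb_unit_conv c c' y : c \in E -> c' \in E -> rsupp a y ->
  emb c c' (pt ek) *c y = emb c a (blk c' a y).
Proof.
move=> Ec Ec' ya; rewrite (emb_conv (a := a) invS pP) //; last exact: CGmem_pt (Gmax1 invS iek).
by rewrite (conv1l invS) //; apply: CGmem_blk.
Qed.

Hypothesis LI : lideal mul inCG L.

Lemma lift_emb c x : c \in E -> L x -> lift (emb c a x).
Proof.
have [[L0 _ _] LA _] := LI.
move=> Ec Lx; split=> [|c' Ec']; first exact: (rsupp_emb invS pP).
by rewrite (blk_emb invS pP) //; [case: ifP | apply: LA].
Qed.

Lemma lift_lideal : lideal mul inCS lift.
Proof.
have [LS LA LM] := LI; have [L0 LD LZ] := LS; split=> //; first split.
- split=> [s _|c Ec]; first exact: (linear0 (kap s)).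
  by rewrite (linear0 (blk c a)).
- move=> x y [xa Lx] [ya Ly]; split=> [s sa|c Ec].
    by rewrite (linearD (kap s)) /= xa // ya // addr0.
  by rewrite (linearD (blk c a)); apply: LD; [apply: Lx | apply: Ly].
- move=> k x [xa Lx]; split=> [s sa|c Ec].
    by rewrite (linearZZ (kap s)) /= xa // scaler0.
  by rewrite (linearZZ (blk c a)); apply: LZ; apply: Lx.
- move=> z y _ [ya Ly]; split=> [|c Ec]; first exact: (rsupp_conv invS).
  rewrite (blk_conv invS pP) //; apply: subspaceP_sum => // c' Ec'.
  by apply: LM; [apply: CGmem_blk | apply: Ly].
Qed.

End LiftIdeal.

(** For a left ideal [M] inside [lift a L], the [x] whose copy in row [ek] lies in [M] form a left
    ideal inside [L], hence zero or [L]. Matrix units spread this to all rows. *)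
Lemma lift_simple a L : a \in E -> simple_lideal mul inCG L -> simple_lideal mul inCS (lift a L).
Proof.
move=> Ea [LI [x0 [Lx0 x00]] Lmin]; have Ee := Eidem_ek.
have [[L0 LD LZ] LA LM] := LI.
have blke x : inCG x -> blk ek a (emb ek a x) = x.
  by move=> xG; rewrite (blk_emb invS pP) // !eqxx.
split; first exact: lift_lideal.
  exists (emb ek a x0); split; first exact: lift_emb.
  by move=> e0; apply: x00; rewrite -(blke x0) ?e0 ?(linear0 (blk ek a)) //; apply: LA.
move=> M [[M0 MD MZ] _ MM] ML.
have [|x [xG Mx]|K0|K1] := Lmin (fun x => inCG x /\ M (emb ek a x)).
- split; first split.
  + by split=> [s _|]; rewrite ?ffunE // (linear0 (emb ek a)).
  + move=> x y [xG Mx] [yG My]; split=> [s sG|]; first by rewrite ffunE xG // yG // addr0.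
    by rewrite (linearD (emb ek a)); apply: MD.
  + move=> k x [xG Mx]; split=> [s sG|]; first by rewrite ffunE xG // scaler0.
    by rewrite (linearZZ (emb ek a)); apply: MZ.
  + by move=> x [].
  + move=> g x gG [xG Mx]; split; first exact: (CGmem_conv invS).
    have -> : emb ek a (g *c x) = emb ek ek g *c emb ek a x.
      by rewrite (emb_conv (a := a) invS pP) ?blke //; apply: (rsupp_emb invS pP).
    exact: MM.
- by have [_ /(_ ek Ee)] := ML _ Mx; rewrite blke.
(* Each entry of [y], moved to row [ek] by a matrix unit, stays in [M], so it is zero. *)
- left=> y My; have [ya Ly] := ML _ My.
  apply: (blk_ext invS pP Ea) => // [s _|c Ec]; first exact: (linear0 (kap s)).
  rewrite (linear0 (blk c a)); apply: K0; split; first exact: CGmem_blk.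
  by rewrite -emb_unit_conv //; apply: MM.
(* Here [y] is the sum of its entries, and each is brought from row [ek] by a matrix unit. *)
- right=> y [ya Ly]; rewrite (emb_blk invS pP Ea ya).
  apply: subspaceP_sum => // c Ec; have [xG Mx] := K1 _ (Ly c Ec).
  rewrite -(blke _ xG) -emb_unit_conv //; first exact: MM.
  exact: (rsupp_emb invS pP).
Qed.

(** The isomorphism applies [phi] to every entry of the column; preimages are assembled entry by
    entry. *)
Lemma lift_iso a L d (rho : S -> 'M[C]_d) : a \in E -> lideal mul inCG L ->
  iso_to mul inCG L (ext rho) -> iso_to mul inCS (lift a L) (bar rho).
Proof.
move=> Ea LI [phi [phiD phiZ phiI phiS phiM]]; have [LS LA LM] := LI.
have LT (y : CS) (i : 'I_#|E|) : lift a L y -> L (blk (enum_val i) a y).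
  by case=> _; apply; apply: enum_valP.
exists (fun y => vglue (fun i : 'I_#|E| => phi (blk (enum_val i) a y))); split.
- move=> x y Lx Ly; apply: vblk_ext => i; rewrite (linearD (vblk i)) /= !vblkK.
  by rewrite (linearD (blk _ a)) /= phiD //; apply: LT.
- move=> k x Lx; apply: vblk_ext => i; rewrite (linearZZ (vblk i)) /= !vblkK.
  by rewrite (linearZZ (blk _ a)) /= phiZ //; apply: LT.
- move=> x y Lx Ly xy; apply: (blk_ext invS pP Ea) => [||c Ec].
  + by case: Lx.
  + by case: Ly.
  + have := congr1 (vblk (enum_rank_in Ec c)) xy; rewrite !vblkK enum_rankK_in //.
    by apply: phiI; [case: Lx => _; apply | case: Ly => _; apply].
- move=> v; have xE (i : 'I_#|E|) : exists x, L x /\ phi x = vblk i v.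
    by have [x] := phiS (vblk i v); exists x.
  have [x xP] := boolp.choice xE.
  have Lx i : L (x i) by case: (xP i).
  exists (\sum_i emb (enum_val i) a (x i)).
    apply: subspaceP_sum; first by case: (lift_lideal Ea LI).
    by move=> i _; apply: lift_emb => //; apply: enum_valP.
  apply: vblk_ext => i; rewrite vblkK (linear_sum (blk _ a)) (bigD1 i) //= big1 => [|j ji].
    by rewrite addr0 (blk_emb invS pP) ?eqxx ?(proj2 (xP i)) ?enum_valP //; apply: LA.
  rewrite (blk_emb invS pP) ?enum_valP //; last exact: LA.
  by rewrite (inj_eq enum_val_inj) eq_sym (negPf ji).
- move=> z y _ Ly; apply: vblk_ext => i; rewrite vblkK rhobar_vblk.
  have Ei := enum_valP i.
  rewrite (blk_conv invS pP) // big_enum_val (linear_on_sum _ LS (conj phiD phiZ)).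
    by apply: eq_bigr => j _; rewrite vblkK phiM //; [apply: CGmem_blk | apply: LT].
  by move=> j _; apply: LM; [apply: CGmem_blk | apply: LT].
Qed.

(* The converse isomorphism is cut out by the idempotent emb ek ek 1, which acts
   on rho-bar as the projection onto the block of ek. *)
Lemma lift_iso_inv a L d (rho : S -> 'M[C]_d) : a \in E -> lideal mul inCG L ->
  grp_rep mul inv ek rho ->
  iso_to mul inCS (lift a L) (bar rho) -> iso_to mul inCG L (ext rho).
Proof.
move=> Ea LI [_ rho1] [phi [phiD phiZ phiI phiS phiM]]; have [LS LA LM] := LI.
have Ee := Eidem_ek; have Ge := Gmax1 invS iek.
have eG : inCG (pt ek) by apply: CGmem_pt.
have [[T0 TD TZ] _ TM] := lift_lideal Ea LI.
pose k0 := enum_rank_in Ee ek.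
have k0E : enum_val k0 = ek by rewrite enum_rankK_in.
have kE (j : 'I_#|E|) : (enum_val j == ek) = (j == k0).
  by rewrite -(inj_eq enum_val_inj) k0E.
have LE x : L x -> lift a L (emb ek a x) by apply: lift_emb.
have blke x : inCG x -> blk ek a (emb ek a x) = x.
  by move=> xG; rewrite (blk_emb invS pP) // !eqxx.
(* Through rho-bar, a matrix with its only entry at (ek, ek) acts by [rho] on block [k0] and kills
   the other blocks. *)
have barE z v i : inCG z ->
    vblk i (bar rho (emb ek ek z) *m v) = if i == k0 then ext rho z *m vblk k0 v else 0.
  move=> zG; rewrite rhobar_vblk (bigD1 k0) //= big1 => [|j jk].
    rewrite addr0 k0E (blk_emb invS pP) ?enum_valP // eqxx andbT kE.
    by case: ifP => _ //; rewrite repext0 mul0mx.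
  rewrite (blk_emb invS pP) ?enum_valP // !kE (negPf jk) andbF.
  by rewrite repext0 mul0mx.
have embE z x : inCG z -> L x -> emb ek a (z *c x) = emb ek ek z *c emb ek a x.
  move=> zG Lx; rewrite (emb_conv (a := a) invS pP) ?blke //; first exact: LA.
  exact: (rsupp_emb invS pP).
have ext1 : ext rho (pt ek) = 1%:M by rewrite repext_pt.
exists (fun x => vblk k0 (phi (emb ek a x))); split.
- move=> x y Lx Ly; rewrite (linearD (emb ek a)) /= phiD; try exact: LE.
  exact: (linearD (vblk k0)).
- move=> c x Lx; rewrite (linearZZ (emb ek a)) /= phiZ; last exact: LE.
  exact: (linearZZ (vblk k0)).
- move=> x y Lx Ly xy; suff : emb ek a x = emb ek a y.
    by move/(congr1 (blk ek a)); rewrite !blke //; apply: LA.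
  apply: phiI; try exact: LE.
  (* The idempotent fixes [phi (emb ek a w)], so this vector is determined by its block [k0]. *)
  have fixE w : L w -> phi (emb ek a w) = bar rho (emb ek ek (pt ek)) *m phi (emb ek a w).
    by move=> Lw; rewrite -phiM //; [rewrite -embE // (conv1l invS) //; apply: LA | apply: LE].
  apply: vblk_ext => i; rewrite fixE // [in RHS]fixE // !barE //.
  by rewrite xy.
(* Any vector with [v] in block [k0] would serve; the one with all blocks equal to [v] is taken. *)
- move=> v; have [y [ya Ly] yv] := phiS (vglue (fun=> v)).
  exists (blk ek a y); first exact: Ly.
  rewrite -(emb_unit_conv Ea Ee Ee ya) phiM // barE // eqxx ext1 mul1mx yv vblkK //.
- by move=> z x zG Lx; rewrite embE // phiM ?barE ?eqxx //; apply: LE.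
Qed.

End Lifting.

(** * Transport of the isotypic projections from CG_k to CS *)

Theorem theoremC2 (R : realType) (S : finType) (mul : S -> S -> S) (inv : S -> S)
  (ek : S) (p : S -> S) (a b : S) (fc : S -> R[i])
  (q : nat) (d : 'I_q -> nat) (rho : forall i : 'I_q, S -> 'M[R[i]]_(d i))
  (fGi : 'I_q -> {ffun S -> R[i]^o}) :
  is_inverse_semigroup mul inv ->
  (* D_k is the D-class of the fixed idempotent e_k *)
  idem mul ek ->
  (* the fixed elements p_e, e an idempotent of D_k *)
  (forall e, e \in Eidem mul inv ek ->
     mul (inv (p e)) (p e) = ek /\ mul (p e) (inv (p e)) = e) ->
  p ek = ek ->
  a \in Eidem mul inv ek -> b \in Eidem mul inv ek ->
  (* f(s) = 0 unless s in D_k, s^-1 s = a, s s^-1 = b *)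
  (forall s, fc s != 0 ->
     [/\ s \in Dclass mul inv ek, mul (inv s) s = a & mul s (inv s) = b]) ->
  (* IRR(G_k) = {rho_1, ..., rho_q} *)
  (forall i, grp_rep mul inv ek (rho i)) ->
  (forall i, irr_rep mul inv ek (rho i)) ->
  (forall i j, i != j -> ~ rep_equiv mul inv ek (rho i) (rho j)) ->
  (forall (d' : nat) (sigma : S -> 'M[R[i]]_d'),
     grp_rep mul inv ek sigma -> irr_rep mul inv ek sigma ->
     exists i, rep_equiv mul inv ek sigma (rho i)) ->
  let f : {ffun S -> R[i]^o} := \sum_(s : S) fc s *: floor (C:=R[i]) mul s in
  let fG : {ffun S -> R[i]^o} :=
    \sum_(s in Dclass mul inv ek | (mul s (inv s) == b) && (mul (inv s) s == a))
       fc s *: pt (C:=R[i]) (mul (inv (p b)) (mul s (p a))) in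
  (* f_G^i = sum_g c_i(g) g is the projection of f_G onto W_i (in CG_k) *)
  (forall i, proj_isotypic mul (CGmem mul inv ek) (repext mul inv ek (rho i)) fG (fGi i)) ->
  let T (i : 'I_q) :=
    conv mul (conv mul (floor (C:=R[i]) mul (p b)) (fGi i)) (floor (C:=R[i]) mul (inv (p a))) in
  [/\ f = \sum_(i < q) T i,
      (forall i, proj_isotypic mul (@CSmem R[i] S) (rhobar mul inv ek p (rho i)) f (T i)) &
      (forall i, T i = conv mul (conv mul (floor (C:=R[i]) mul (p b))
                         (\sum_(g in Gmax mul inv ek) fGi i g *: floor (C:=R[i]) mul g))
                         (floor (C:=R[i]) mul (inv (p a))))].
Proof.
move=> invS iek pP _ Ea Eb fcP rhoR rhoI rho_inj rho_compl f fG fGiP T.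
have fGG : CGmem mul inv ek fG.
  apply: CGmem_sum => s /andP[_ /andP[/eqP rs /eqP ds]] g gG.
  have Gu : mul (inv (p b)) (mul s (p a)) \in Gmax mul inv ek.
    by rewrite (smulA invS); apply: (unarrowG invS pP).
  by rewrite ffunE (CGmem_pt _ Gu gG) scaler0.
(* Since [arrow] undoes [unarrow], [emb] sends each term of [fG] to the matching term of [f]. The
   terms of [f] absent from [fG] have coefficient zero. *)
have fE : f = emb mul inv ek p b a fG.
  rewrite /fG (linear_sum (emb mul inv ek p b a)) /f.
  rewrite [RHS]big_mkcond; apply: eq_bigr => s _; case: ifP => [|/negbT sN]; last first.
    have [->|/fcP[sD ds rs]] := eqVneq (fc s) 0; first by rewrite scale0r.
    by rewrite sD ds rs !eqxx in sN.
  case/andP=> _ /andP[/eqP rs /eqP ds].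
  rewrite (linearZZ (emb mul inv ek p b a)) (smulA invS) /= emb_pt; last exact: (unarrowG invS pP).
  by rewrite (unarrowK invS pP).
have fGiG i : CGmem mul inv ek (fGi i).
  have [[n [Ls [xs [xsP ->]]]] _] := fGiP i; apply: CGmem_sum => j _.
  by have [[[_ LA _] _ _] _ /LA] := xsP j.
have TE i : T i = emb mul inv ek p b a (fGi i) by apply: (floor_conv_emb invS pP).
split=> [|i|i]; last by rewrite TE (floor_conv_emb_floor invS pP).
  rewrite fE (isotypic_sum invS iek rhoR rhoI rho_inj rho_compl fGG fGiP).
  by rewrite (linear_sum (emb mul inv ek p b a)); apply: eq_bigr => i _; rewrite TE.
(* The decompositions of [fGi i] and [fG - fGi i] along simple left ideals are carried by [emb] to
   decompositions of [T i] and [f - T i] along the lifted ideals. *)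
have [[n [Ls [xs [xsP fGiE]]]] [n' [Ls' [xs' [xsP' fGiE']]]]] := fGiP i.
split.
  exists n, (fun j => lift mul inv ek p a (Ls j)), (fun j => emb mul inv ek p b a (xs j)).
  split=> [j|]; last by rewrite TE fGiE (linear_sum (emb mul inv ek p b a)).
  have [sL isoL Lx] := xsP j; have [LI _ _] := sL; split.
  - exact: (lift_simple invS iek pP).
  - exact: (lift_iso invS pP).
  - exact: (lift_emb invS pP).
exists n', (fun j => lift mul inv ek p a (Ls' j)), (fun j => emb mul inv ek p b a (xs' j)).
split=> [j|]; last first.
  by rewrite TE fE -(linearB (emb mul inv ek p b a)) fGiE' (linear_sum (emb mul inv ek p b a)).
have [sL isoL Lx] := xsP' j; have [LI _ _] := sL; split.
- exact: (lift_simple invS iek pP).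
(* An isomorphism of the lifted ideal with rho-bar would descend to one of [Ls' j] with [rho i]. *)
- by move/(lift_iso_inv invS iek pP Ea LI (rhoR i)).
- exact: (lift_emb invS pP).
Qed.
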